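(* Let $f(z)=z+\sum_{n=2}^{\infty}a_nz^n$ belong to $\mathcal{S}^*_{ch}$, and let $\Gamma_1,\Gamma_2$ be the first two logarithmic inverse coefficients of $f$, i.e. $$\Gamma_1=-\tfrac12 a_2,\qquad \Gamma_2=-\tfrac12\Big(a_3-\tfrac32 a_2^2\Big).$$ Then $|\Gamma_1|\le\frac12$ and $|\Gamma_2|\le\frac38$. Both inequalities are sharp, with equality for $f_1(z)=z\exp\left(\int_0^z\frac{t+\cosh t-1}{t}\,dt\right)$, which belongs to $\mathcal{S}^*_{ch}$.
   Context: $\mathbb{D}=\{z\in\mathbb{C}:|z|<1\}$. $\mathcal{A}$ is the class of analytic $f$ on $\mathbb{D}$ with $f(0)=0$, $f'(0)=1$. For analytic $g,h$ on $\mathbb{D}$, $g\prec h$ means there is an analytic $\omega$ on $\mathbb{D}$ with $\omega(0)=0$, $|\omega(z)|<1$, and $g=h\circ\omega$. $\mathcal{S}^*_{ch}$ is the class of $f\in\mathcal{A}$ with $\frac{zf'(z)}{f(z)}\prec z+\cosh z$ on $\mathbb{D}$. For such $f$ with inverse $F=f^{-1}$ defined near $0$, the logarithmic inverse coefficients $\Gamma_n$ are defined by $\log\frac{f^{-1}(w)}{w}=2\sum_{n\ge1}\Gamma_nw^n$ for $w$ near $0$; the displayed formulas for $\Gamma_1,\Gamma_2$ in terms of $a_2,a_3$ follow from this definition. *)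

(* Defs.v *)
From Stdlib Require Import Reals.
From Coquelicot Require Import Coquelicot.
Open Scope C_scope.

Definition inD (z : C) : Prop := (Cmod z < 1)%R.

Definition cderiv (f : C -> C) (z l : C) : Prop :=
  is_derive (K := C_AbsRing) (V := C_NormedModule) f z l.

Definition analytic_on_D (f : C -> C) : Prop :=
  forall z, inD z -> exists l, cderiv f z l.

Definition cexp (z : C) : C :=
  (exp (Re z) * cos (Im z), exp (Re z) * sin (Im z))%R.
Definition ccosh (z : C) : C := (cexp z + cexp (- z)) / RtoC 2.

Definition phi_ch (z : C) : C := z + ccosh z.

Definition classA (f : C -> C) : Prop :=
  analytic_on_D f /\ f (RtoC 0) = RtoC 0 /\ cderiv f (RtoC 0) (RtoC 1).

Definition subordinate (g h : C -> C) : Prop :=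
  exists w : C -> C, analytic_on_D w /\ w (RtoC 0) = RtoC 0 /\
    (forall z, inD z -> (Cmod (w z) < 1)%R) /\
    (forall z, inD z -> g z = h (w z)).

(* z f'(z) / f(z), with its removable singularity at 0 filled in by the value 1
   (= lim_{z->0} z f'(z)/f(z) for f in A); fp is the derivative of f. *)
Definition zfp_over_f (f fp : C -> C) (z : C) : C :=
  if Ceq_dec z (RtoC 0) then RtoC 1 else z * fp z / f z.

Definition S_ch (f : C -> C) : Prop :=
  classA f /\
  exists fp : C -> C,
    (forall z, inD z -> cderiv f z (fp z)) /\
    (forall z, inD z -> z <> RtoC 0 -> f z <> RtoC 0) /\
    analytic_on_D (zfp_over_f f fp) /\
    subordinate (zfp_over_f f fp) phi_ch.

Definition taylor_coeffs (f : C -> C) (a : nat -> C) : Prop :=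
  forall z, inD z -> is_series (K := C_AbsRing) (V := C_NormedModule)
                        (fun n => a n * pow_n z n) (f z).

Definition Gamma1 (a : nat -> C) : C := - (a 2%nat) / RtoC 2.
Definition Gamma2 (a : nat -> C) : C :=
  - (a 3%nat - RtoC (3/2) * (a 2%nat * a 2%nat)) / RtoC 2.

(* The extremal function f_1(z) = z exp( int_0^z (t + cosh t - 1)/t dt ),
   the integral taken along the segment [0, z] (t = s z, s in [0,1]):
   int_0^z (t + cosh t - 1)/t dt = int_0^1 (s z + cosh (s z) - 1)/s ds. *)
Definition f1 (z : C) : C :=
  z * cexp (RInt (V := C_R_CompleteNormedModule)
              (fun s : R => (RtoC s * z + ccosh (RtoC s * z) - RtoC 1) / RtoC s)
              0%R 1%R).

(* Main.v *)
(** If [z f'(z) / f(z) = phi_ch (w z)] with a Schwarz function [w], comparing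
    expansions at [0] gives [w z = c1 z + c2 z^2 + O(z^3)] with [c1 = a 2] and
    [c2 = 2 a 3 - 3/2 (a 2)^2], so that [Gamma1 = - c1/2] and
    [Gamma2 = - c2/4 + 3/8 c1^2]; both bounds follow from [|c2| <= 1 - |c1|^2].
    That inequality is obtained by averaging [w(z) (1 + y z)^2 / z^2] over circles:
    the mean does not depend on the radius (Goursat's theorem in logarithmic
    coordinates), equals [c2 + 2 y c1] in the limit of radius 0, and is at most
    [1 + |y|^2] in the limit of radius 1; then take [y] to be the conjugate of [c1]
    times the phase of [c2].  The function [f1] has [w z = z], and its power series
    is [z E(z)], where [E] solves [E' = E (z + cosh z - 1)/z]. *)
Require Import Defs.
From Stdlib Require Import Reals Lra Lia Psatz Arith Factorial ClassicalEpsilon.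
From Coquelicot Require Import Coquelicot.
Open Scope C_scope.

(* Coquelicot's generic lemmas leave equalities in the carrier of a packed
   structure, where [ring] does not find the ring. *)
Ltac as_R := match goal with |- @eq _ ?a ?b => change (@eq R a b) end.
Ltac as_C := match goal with |- @eq _ ?a ?b => change (@eq C a b) end.

(** * Complex derivatives *)

(** Analyticity is pointwise complex differentiability: for the Schwarz function [w] neither a
    continuous derivative nor a power series is assumed. Its expansion at 0 is therefore extracted
    from the functional equation, with the Taylor series of [f] as input, and the means over circles
    rest on a bisection argument. The factor (1 + y z)^2 / z^2 serves two purposes. Its product with
    c1 z + c2 z^2 has constant term c2 + 2 y c1, and on a circle |1 + y z|^2 is a constant plus a
    first harmonic, so that its mean is elementary. The final choice of y turns the estimate into
    |c2| + 2 |c1|^2 <= 1 + |c1|^2. The constant 3/8 comes from |c2|/4 + 3 |c1|^2/8 <= 1/4 +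
    |c1|^2/8, which is largest at |c1| = 1, c2 = 0: the values for w z = z. For [f1] the obstacle is
    the removable singularity of (z + cosh z - 1)/z at 0. The quotient is replaced by a power
    series, and the differential equation identifies the series E with the exponential of the
    integral. *)

Lemma cderiv_iff (f : C -> C) (z l : C) :
  cderiv f z l <->
  forall e : R, (0 < e)%R -> exists d : R, (0 < d)%R /\
    forall y : C, (Cmod (y - z) < d)%R ->
      (Cmod (f y - f z - l * (y - z)) <= e * Cmod (y - z))%R.
Proof.
  split.
  - intros [_ H] e He.
    destruct (H z (fun P HP => HP) (mkposreal e He)) as [d Hd].
    exists d; split; [apply cond_pos | intros y Hy].
    specialize (Hd y Hy).
    change (Cmod (f y - f z - (y - z) * l) <= e * Cmod (y - z))%R in Hd.
    now rewrite (Cmult_comm l).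
  - intros H; split.
    + apply is_linear_scal_l.
    + intros x Hx e.
      rewrite <- (is_filter_lim_locally_unique _ _ Hx).
      destruct (H e (cond_pos e)) as [d [Hd0 Hd]].
      exists (mkposreal d Hd0); intros y Hy.
      specialize (Hd y Hy).
      change (Cmod (f y - f z - (y - z) * l) <= e * Cmod (y - z))%R.
      now rewrite (Cmult_comm (y - z)).
Qed.

Lemma cderiv_const (a z : C) : cderiv (fun _ => a) z 0.
Proof. exact (is_derive_const (K := C_AbsRing) (V := C_NormedModule) a z). Qed.

(* The two normed modules on [C] differ in their uniform structure only: discs on
   the left, squares on the right. *)
Lemma cderiv_AbsRing (f : C -> C) (z l : C) :
  is_derive (K := C_AbsRing) (V := AbsRing_NormedModule C_AbsRing) f z l <-> cderiv f z l.
Proof.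
  split; (intros [_ H]; split; [apply is_linear_scal_l | exact H]).
Qed.

Lemma cderiv_id (z : C) : cderiv (fun y => y) z 1.
Proof. apply cderiv_AbsRing. exact (is_derive_id (K := C_AbsRing) z). Qed.

Lemma cderiv_plus (f g : C -> C) (z a b : C) :
  cderiv f z a -> cderiv g z b -> cderiv (fun y => f y + g y) z (a + b).
Proof. exact (is_derive_plus (K := C_AbsRing) (V := C_NormedModule) f g z a b). Qed.

Lemma cderiv_mult (f g : C -> C) (z a b : C) :
  cderiv f z a -> cderiv g z b -> cderiv (fun y => f y * g y) z (a * g z + f z * b).
Proof.
  rewrite <- !cderiv_AbsRing. intros Hf Hg.
  exact (is_derive_mult (K := C_AbsRing) f g z a b Hf Hg Cmult_comm).
Qed.

Lemma cderiv_comp (f g : C -> C) (z a b : C) :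
  cderiv f (g z) a -> cderiv g z b -> cderiv (fun y => f (g y)) z (a * b).
Proof.
  intros Hf Hg. rewrite Cmult_comm. rewrite <- cderiv_AbsRing in Hg.
  exact (is_derive_comp (K := C_AbsRing) (V := C_NormedModule) f g z a b Hf Hg).
Qed.

Lemma cderiv_opp_id (z : C) : cderiv Copp z (- (1)).
Proof.
  exact (is_derive_opp (K := C_AbsRing) (V := C_NormedModule) (fun y => y) z (RtoC 1)
    (cderiv_id z)).
Qed.

Lemma cderiv_ext_near (f g : C -> C) (z l : C) (d : R) :
  (0 < d)%R -> (forall y, (Cmod (y - z) < d)%R -> f y = g y) -> cderiv f z l -> cderiv g z l.
Proof.
  intros Hd H.
  apply (is_derive_ext_loc (K := C_AbsRing) (V := C_NormedModule) f g z l).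
  exists (mkposreal d Hd). intros y Hy. now apply H.
Qed.

Lemma inD_near (z y : C) : inD z -> (Cmod (y - z) < 1 - Cmod z)%R -> inD y.
Proof.
  unfold inD; intros Hz Hy.
  generalize (Cmod_triangle (y - z) z). replace (y - z + z) with y by ring. lra.
Qed.

Lemma cderiv_ext_D (f g : C -> C) (z l : C) :
  inD z -> (forall y, inD y -> f y = g y) -> cderiv f z l -> cderiv g z l.
Proof.
  intros Hz H. apply (cderiv_ext_near f g z l (1 - Cmod z)); [unfold inD in Hz; lra|].
  intros y Hy. apply H. now apply (inD_near z).
Qed.

Lemma Cmod_minus_sym (x y : C) : Cmod (x - y) = Cmod (y - x).
Proof. rewrite <- Cmod_opp. f_equal. ring. Qed.

Lemma Cmod_triangle_minus (x y : C) : (Cmod (x - y) <= Cmod x + Cmod y)%R.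
Proof. unfold Cminus. rewrite <- (Cmod_opp y). apply Cmod_triangle. Qed.

Lemma Cmod_reverse_triangle (x y : C) : (Cmod x - Cmod y <= Cmod (x - y))%R.
Proof. generalize (Cmod_triangle (x - y) y). replace (x - y + y) with x by ring. lra. Qed.

Lemma cderiv_inv (z : C) : z <> 0 -> cderiv Cinv z (- / (z * z)).
Proof.
  intros Hz. apply cderiv_iff. intros e He.
  assert (Hm := proj1 (Cmod_gt_0 z) Hz).
  set (m := Cmod z) in *.
  (* The remainder is exactly (y - z)^2 / (z^2 y). The first radius keeps |y| >= m/2; the second
     then makes |y - z| / (m^2 |y|) at most e. *)
  exists (Rmin (m / 2) (e * (m * m * m) / 2)). split.
  { apply Rmin_glb_lt; [lra|].
    apply Rdiv_lt_0_compat; [repeat apply Rmult_lt_0_compat; lra | lra]. }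
  intros y Hy.
  assert (H1 := Rlt_le_trans _ _ _ Hy (Rmin_l _ _)).
  assert (H2 := Rlt_le_trans _ _ _ Hy (Rmin_r _ _)).
  assert (Hym : (m / 2 <= Cmod y)%R).
  { generalize (Cmod_reverse_triangle z y). rewrite Cmod_minus_sym. fold m. lra. }
  assert (Hy0 : y <> 0) by (apply Cmod_gt_0; lra).
  replace (/ y - / z - - / (z * z) * (y - z)) with ((y - z) * ((y - z) / (z * z * y)))
    by (field; auto).
  rewrite Cmod_mult, (Rmult_comm e). apply Rmult_le_compat_l; [apply Cmod_ge_0|].
  rewrite Cmod_div by (repeat apply Cmult_neq_0; auto).
  rewrite !Cmod_mult. fold m.
  apply Rmult_le_reg_r with (m * m * Cmod y)%R; [repeat apply Rmult_lt_0_compat; lra|].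
  unfold Rdiv. rewrite Rmult_assoc, Rinv_l, Rmult_1_r
    by (apply Rgt_not_eq; repeat apply Rmult_lt_0_compat; lra).
  apply Rle_trans with (1 := Rlt_le _ _ H2).
  replace (e * (m * m * m) / 2)%R with (e * (m * m * (m / 2)))%R by field.
  apply Rmult_le_compat_l; [lra|]. apply Rmult_le_compat_l; [|lra].
  apply Rmult_le_pos; lra.
Qed.

Lemma cderiv_continuous (f : C -> C) (z l : C) : cderiv f z l ->
  forall e : R, (0 < e)%R -> exists d : R, (0 < d)%R /\
    forall y, (Cmod (y - z) < d)%R -> (Cmod (f y - f z) < e)%R.
Proof.
  intros H e He.
  destruct (proj1 (cderiv_iff f z l) H 1%R Rlt_0_1) as [d [Hd Hf]].
  assert (Hl := Cmod_ge_0 l).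
  assert (He' : (0 < e / (2 + Cmod l))%R) by (apply Rdiv_lt_0_compat; lra).
  exists (Rmin d (e / (2 + Cmod l))). split; [now apply Rmin_glb_lt|].
  intros y Hy.
  specialize (Hf y (Rlt_le_trans _ _ _ Hy (Rmin_l _ _))).
  assert (H2 := Rlt_le_trans _ _ _ Hy (Rmin_r _ _)).
  replace (f y - f z) with (f y - f z - l * (y - z) + l * (y - z)) by ring.
  apply Rle_lt_trans with (1 := Cmod_triangle _ _). rewrite Cmod_mult.
  apply Rle_lt_trans with ((1 + Cmod l) * (e / (2 + Cmod l)))%R.
  - assert (Hc := Cmod_ge_0 (y - z)). nra.
  - apply Rmult_lt_reg_r with (2 + Cmod l)%R; [lra|].
    replace ((1 + Cmod l) * (e / (2 + Cmod l)) * (2 + Cmod l))%R with ((1 + Cmod l) * e)%R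
      by (field; lra). nra.
Qed.

Lemma is_derive_R_C_iff (g : R -> C) (t : R) (l : C) :
  is_derive (K := R_AbsRing) (V := C_R_NormedModule) g t l <->
  forall e : R, (0 < e)%R -> exists d : R, (0 < d)%R /\
    forall u : R, (Rabs (u - t) < d)%R ->
      (Cmod (g u - g t - RtoC (u - t) * l) <= e * Rabs (u - t))%R.
Proof.
  assert (E : forall (u : R) (x : C), scal (V := C_R_NormedModule) u x = RtoC u * x).
  { intros u [x1 x2]. apply injective_projections; simpl; unfold scal; simpl; unfold mult; simpl; ring. }
  split.
  - intros [_ H] e He.
    destruct (H t (fun P HP => HP) (mkposreal e He)) as [d Hd].
    exists d; split; [apply cond_pos | intros u Hu].
    specialize (Hd u Hu). rewrite E, <- Cmod_norm in Hd. exact Hd.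
  - intros H; split.
    + apply is_linear_scal_l.
    + intros x Hx e.
      rewrite <- (is_filter_lim_locally_unique _ _ Hx).
      destruct (H e (cond_pos e)) as [d [Hd0 Hd]].
      exists (mkposreal d Hd0); intros u Hu.
      rewrite E, <- Cmod_norm. exact (Hd u Hu).
Qed.

Lemma is_derive_along_line (f : C -> C) (z v l : C) (t : R) :
  cderiv f (z + RtoC t * v) l ->
  is_derive (K := R_AbsRing) (V := C_R_NormedModule) (fun s : R => f (z + RtoC s * v)) t (l * v).
Proof.
  intros H. apply is_derive_R_C_iff. intros e He.
  assert (Hv := Cmod_ge_0 v).
  (* Dividing by [1 + Cmod v] instead of [Cmod v] covers the direction [v = 0]. *)
  destruct (proj1 (cderiv_iff _ _ _) H (e / (1 + Cmod v))%R) as [d [Hd Hf]].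
  { apply Rdiv_lt_0_compat; lra. }
  exists (d / (1 + Cmod v))%R. split; [apply Rdiv_lt_0_compat; lra|].
  intros u Hu.
  assert (E : z + RtoC u * v - (z + RtoC t * v) = RtoC (u - t) * v)
    by (rewrite RtoC_minus; ring).
  specialize (Hf (z + RtoC u * v)). rewrite E, Cmod_mult, Cmod_R in Hf.
  replace (RtoC (u - t) * (l * v)) with (l * (RtoC (u - t) * v)) by ring.
  assert (Hu0 := Rabs_pos (u - t)).
  assert (Hu1 : (Rabs (u - t) * (1 + Cmod v) < d)%R).
  { apply Rmult_lt_reg_r with (/ (1 + Cmod v))%R; [apply Rinv_0_lt_compat; lra|].
    rewrite Rmult_assoc, Rinv_r, Rmult_1_r by lra. exact Hu. }
  apply Rle_trans with (1 := Hf ltac:(nra)).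
  replace (e / (1 + Cmod v) * (Rabs (u - t) * Cmod v))%R
    with (e * Rabs (u - t) * (Cmod v / (1 + Cmod v)))%R by (field; lra).
  rewrite <- (Rmult_1_r (e * Rabs (u - t))) at 2.
  apply Rmult_le_compat_l; [apply Rmult_le_pos; lra|].
  apply Rmult_le_reg_r with (1 + Cmod v)%R; [lra|].
  unfold Rdiv. rewrite Rmult_assoc, Rinv_l by lra. lra.
Qed.

(** The segment from 0 to [z] stays in the disc, and along it [f] is a function of one real variable
    with zero derivative. *)
Lemma cderiv_zero_constant_D (f : C -> C) :
  (forall z, inD z -> cderiv f z 0) -> forall z, inD z -> f z = f 0.
Proof.
  intros H z Hz.
  assert (E := eq_is_derive (V := C_R_NormedModule) (fun s : R => f (0 + RtoC s * z)) 0 1).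
  simpl in E.
  replace (0 + RtoC 1 * z) with z in E by ring.
  replace (0 + RtoC 0 * z) with (RtoC 0) in E by ring.
  symmetry. apply E; [|lra].
  intros t Ht.
  replace (@zero C_R_NormedModule) with (0 * z) by (apply Cmult_0_l).
  apply is_derive_along_line. apply H.
  unfold inD in *. rewrite Cplus_0_l, Cmod_mult, Cmod_R, Rabs_pos_eq by lra.
  generalize (Cmod_ge_0 z). nra.
Qed.


(** * Power series on the unit disc *)

Notation is_Cseries := (is_series (K := C_AbsRing) (V := C_NormedModule)).

Lemma is_Cseries_iff (u : nat -> C) (l : C) :
  is_Cseries u l <->
  forall e : R, (0 < e)%R -> exists N : nat, forall n, (N <= n)%nat ->
    (Cmod (sum_n (G := C_AbelianMonoid) u n - l) < e)%R.
Proof.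
  assert (E := filterlim_locally_ball_norm (K := C_AbsRing) (U := C_NormedModule)
    (F := eventually) (sum_n u) l).
  split.
  - intros H e He. destruct (proj1 E H (mkposreal e He)) as [N HN].
    exists N. intros n Hn. exact (HN n Hn).
  - intros H. apply E. intros e. destruct (H e (cond_pos e)) as [N HN].
    exists N. intros n Hn. exact (HN n Hn).
Qed.

Lemma Cmod_sum_n_le (u : nat -> C) (v : nat -> R) (n : nat) :
  (forall k, (k <= n)%nat -> (Cmod (u k) <= v k)%R) ->
  (Cmod (sum_n (G := C_AbelianMonoid) u n) <= sum_n v n)%R.
Proof.
  intros H. induction n as [|n IH].
  - rewrite !sum_O. now apply H.
  - rewrite !sum_Sn. apply Rle_trans with (1 := Cmod_triangle _ _).
    apply Rplus_le_compat; [apply IH; intros k Hk; apply H; lia | now apply H].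
Qed.

Lemma is_Cseries_Cmod_le (u : nat -> C) (l : C) (v : nat -> R) (L : R) :
  is_Cseries u l -> is_series v L -> (forall n, (Cmod (u n) <= v n)%R) -> (Cmod l <= L)%R.
Proof.
  intros Hu Hv H. apply le_epsilon. intros e He.
  destruct (proj1 (is_Cseries_iff u l) Hu (e / 2)%R ltac:(lra)) as [N HN].
  assert (Hv' : is_lim_seq (sum_n v) L) by exact Hv.
  apply is_lim_seq_spec in Hv'.
  destruct (Hv' (mkposreal (e / 2) ltac:(lra))) as [N' HN']. simpl in HN'.
  specialize (HN (N + N')%nat ltac:(lia)). specialize (HN' (N + N')%nat ltac:(lia)).
  apply Rabs_lt_between' in HN'.
  generalize (Cmod_sum_n_le u v (N + N') (fun k _ => H k)).
  rewrite Cmod_minus_sym in HN.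
  generalize (Cmod_reverse_triangle l (sum_n (G := C_AbelianMonoid) u (N + N'))). lra.
Qed.

Lemma is_Cseries_unique (u : nat -> C) (a b : C) : is_Cseries u a -> is_Cseries u b -> a = b.
Proof. intros Ha Hb. exact (filterlim_locally_unique _ a b Ha Hb). Qed.

Lemma is_Cseries_tail (u : nat -> C) (l : C) :
  is_Cseries u l -> u 0%nat = 0 -> is_Cseries (fun n => u (S n)) l.
Proof.
  intros H H0. apply is_series_incr_1. rewrite H0.
  change (is_Cseries u (l + 0)). now rewrite Cplus_0_r.
Qed.

Lemma is_Cseries_bounded (u : nat -> C) (l : C) :
  is_Cseries u l -> exists M, forall n, (Cmod (u n) <= M)%R.
Proof.
  intros Hu.
  destruct (proj1 (is_Cseries_iff u l) Hu 1%R Rlt_0_1) as [N HN].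
  assert (B : exists M, forall n, (n <= N)%nat -> (Cmod (u n) <= M)%R).
  { clear HN. induction N as [|N [M HM]].
    - exists (Cmod (u 0%nat)). intros n Hn. replace n with 0%nat by lia. lra.
    - exists (Rmax M (Cmod (u (S N)))). intros n Hn.
      destruct (Nat.eq_dec n (S N)) as [->|Hne]; [apply Rmax_r|].
      apply Rle_trans with (2 := Rmax_l _ _). apply HM. lia. }
  destruct B as [M HM]. exists (Rmax M 2). intros n.
  destruct (Nat.le_gt_cases n N) as [Hn|Hn].
  { apply Rle_trans with (2 := Rmax_l _ _). now apply HM. }
  apply Rle_trans with (2 := Rmax_r _ _).
  destruct n as [|n]; [lia|].
  assert (H1 := HN n ltac:(lia)). assert (H2 := HN (S n) ltac:(lia)).
  rewrite sum_Sn in H2. change (plus (G := C_AbelianMonoid)) with Cplus in H2.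
  set (s := sum_n (G := C_AbelianMonoid) u n) in *.
  replace (u (S n)) with ((s + u (S n) - l) - (s - l)) by ring.
  apply Rle_trans with (1 := Cmod_triangle_minus _ _). lra.
Qed.

Lemma pow_n_Cpow (z : C) (n : nat) : pow_n (K := C_AbsRing) z n = z ^ n.
Proof. induction n as [|n IH]; [reflexivity | simpl; rewrite IH; reflexivity]. Qed.

Lemma taylor_coeffs_iff (f : C -> C) (a : nat -> C) :
  taylor_coeffs f a <-> forall z, inD z -> is_Cseries (fun n => a n * z ^ n) (f z).
Proof.
  split; intros H z Hz.
  - apply is_series_ext with (2 := H z Hz). intros n. now rewrite <- pow_n_Cpow.
  - apply is_series_ext with (2 := H z Hz). intros n. now rewrite <- pow_n_Cpow.
Qed.

(** Turns a coefficient sequence into a function: the sum is selected pointwise by [epsilon],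
    convergence on the disc coming from comparison with a geometric series. Values off the disc are
    arbitrary. *)
Lemma taylor_coeffs_bounded_ex (a : nat -> C) (M : R) :
  (forall n, (Cmod (a n) <= M)%R) -> exists f, taylor_coeffs f a.
Proof.
  intros H.
  exists (fun z => epsilon (inhabits (RtoC 0)) (fun l => is_Cseries (fun n => a n * z ^ n) l)).
  apply taylor_coeffs_iff. intros z Hz. apply epsilon_spec.
  apply (ex_series_le (K := C_AbsRing) (V := C_CompleteNormedModule)
    (fun n => a n * z ^ n) (fun n => M * Cmod z ^ n)%R).
  - intros n. change (Cmod (a n * z ^ n) <= M * Cmod z ^ n)%R. rewrite Cmod_mult, Cmod_pow.
    apply Rmult_le_compat_r; [apply pow_le, Cmod_ge_0 | apply H].
  - apply (ex_series_scal (K := R_AbsRing) (V := R_NormedModule) M). apply ex_series_geom.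
    rewrite Rabs_pos_eq by apply Cmod_ge_0. exact Hz.
Qed.

(** Passing to the moduli of the coefficients makes the theory of real power series applicable. The
    terms are bounded at a point [s] strictly between [r] and 1, so the radius is at least [s]. *)
Lemma taylor_coeffs_CV_radius (f : C -> C) (a : nat -> C) (r : R) :
  taylor_coeffs f a -> (0 <= r < 1)%R -> Rbar_lt r (CV_radius (fun n => Cmod (a n))).
Proof.
  intros H Hr. rewrite taylor_coeffs_iff in H.
  set (s := ((r + 1) / 2)%R).
  assert (Hs : (0 <= s < 1)%R) by (unfold s; lra).
  destruct (is_Cseries_bounded _ _ (H (RtoC s) ltac:(unfold inD; rewrite Cmod_R, Rabs_pos_eq; lra)))
    as [M HM].
  apply Rbar_lt_le_trans with s; [simpl; unfold s; lra|].
  apply (proj1 (CV_radius_bounded _)). exists M. intros n.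
  specialize (HM n). rewrite Cmod_mult, Cmod_pow, Cmod_R, (Rabs_pos_eq s) in HM by lra.
  rewrite Rabs_pos_eq; [exact HM|].
  apply Rmult_le_pos; [apply Cmod_ge_0 | apply pow_le; lra].
Qed.

(** The sum of this series is the constant in the quadratic remainder estimate behind termwise
    differentiation. *)
Lemma ex_series_derive2 (f : C -> C) (a : nat -> C) (r : R) :
  taylor_coeffs f a -> (0 <= r < 1)%R ->
  ex_series (fun n => (INR (S (S n)) * INR (S n) * Cmod (a (S (S n))) * r ^ n)%R).
Proof.
  intros H Hr.
  assert (Hc := taylor_coeffs_CV_radius f a r H Hr).
  rewrite <- CV_radius_derive, <- CV_radius_derive in Hc.
  rewrite <- (Rabs_pos_eq r) in Hc by lra.
  apply CV_disk_inside in Hc.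
  apply ex_series_ext with (2 := Hc). intros n. unfold PS_derive.
  rewrite Rabs_pos_eq; [as_R; ring|].
  repeat apply Rmult_le_pos; try apply pos_INR; [apply Cmod_ge_0 | apply pow_le; lra].
Qed.

(** Induction on the exponent m = n + 2: the remainder for m + 1 is [w] times the remainder for m,
    plus m z^(m-1) (w - z)^2. The resulting factor m^2 is absorbed by (m + 1) m. *)
Lemma pow_second_order (z w : C) (r : R) (n : nat) :
  (Cmod z <= r)%R -> (Cmod w <= r)%R ->
  (Cmod (w ^ S (S n) - z ^ S (S n) - RtoC (INR (S (S n))) * z ^ S n * (w - z))
   <= INR (S (S n)) * INR (S n) * r ^ n * (Cmod (w - z) * Cmod (w - z)))%R.
Proof.
  intros Hz Hw. assert (Hz0 := Cmod_ge_0 z).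
  induction n as [|n IH].
  - simpl (INR _). replace (w ^ 2 - z ^ 2 - RtoC (1 + 1) * z ^ 1 * (w - z)) with ((w - z) * (w - z)).
    + rewrite Cmod_mult. simpl. assert (H := Cmod_ge_0 (w - z)). nra.
    + rewrite RtoC_plus. ring.
  - set (m := S (S n)) in *.
    replace (w ^ S m - z ^ S m - RtoC (INR (S m)) * z ^ m * (w - z))
      with (w * (w ^ m - z ^ m - RtoC (INR m) * z ^ S n * (w - z))
            + RtoC (INR m) * z ^ S n * ((w - z) * (w - z))).
    2: { rewrite (S_INR m), RtoC_plus. unfold m. rewrite !Cpow_S. ring. }
    set (D := (Cmod (w - z) * Cmod (w - z))%R) in *.
    assert (HD : (0 <= D)%R) by (apply Rmult_le_pos; apply Cmod_ge_0).
    apply Rle_trans with (1 := Cmod_triangle _ _). rewrite !Cmod_mult. fold D.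
    rewrite Cmod_R, Rabs_pos_eq by apply pos_INR. rewrite Cmod_pow.
    apply Rle_trans with (r * (INR m * INR (S n) * r ^ n * D) + INR m * r ^ S n * D)%R.
    + apply Rplus_le_compat.
      * apply Rmult_le_compat; try apply Cmod_ge_0; assumption.
      * apply Rmult_le_compat_r; [assumption|].
        apply Rmult_le_compat_l; [apply pos_INR|]. apply pow_incr; lra.
    + replace (r * (INR m * INR (S n) * r ^ n * D) + INR m * r ^ S n * D)%R
        with (INR m * INR m * (r ^ S n * D))%R.
      2: { unfold m at 2. rewrite (S_INR (S n)). simpl. ring. }
      replace (INR (S m) * INR m * r ^ S n * D)%R with (INR (S m) * INR m * (r ^ S n * D))%R by ring.
      apply Rmult_le_compat_r.
      * apply Rmult_le_pos; [apply pow_le; lra | assumption].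
      * rewrite (S_INR m). generalize (pos_INR m). nra.
Qed.

(** Summing the estimates for monomials over |w| <= r gives |f w - f z - l (w - z)| <= L |w - z|^2,
    where [l] is the termwise derivative and [L] sums the second-derivative majorant at [r], halfway
    between |z| and 1. *)
Lemma taylor_coeffs_derive (f : C -> C) (a : nat -> C) :
  taylor_coeffs f a ->
  (forall z, inD z -> cderiv f z (C_derive f z)) /\
  taylor_coeffs (C_derive f) (fun n => RtoC (INR (S n)) * a (S n)).
Proof.
  intros H.
  assert (K : forall z, inD z -> exists l,
    is_Cseries (fun n => RtoC (INR (S n)) * a (S n) * z ^ n) l /\ cderiv f z l).
  2: { split.
       - intros z Hz. destruct (K z Hz) as [l [_ Hl]].
         now rewrite (is_C_derive_unique f z l Hl).
       - apply taylor_coeffs_iff. intros z Hz. destruct (K z Hz) as [l [Hs Hl]].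
         now rewrite (is_C_derive_unique f z l Hl). }
  intros z Hz. unfold inD in Hz. assert (Hz0 := Cmod_ge_0 z).
  set (r := ((Cmod z + 1) / 2)%R).
  assert (Hr : (0 <= r < 1)%R) by (unfold r; lra).
  assert (Hzr : (Cmod z < r)%R) by (unfold r; lra).
  assert (Hex : ex_series (K := C_AbsRing) (V := C_NormedModule)
    (fun n => RtoC (INR (S n)) * a (S n) * z ^ n)).
  { apply (ex_series_le (K := C_AbsRing) (V := C_CompleteNormedModule) _
      (fun n => Rabs (PS_derive (fun n => Cmod (a n)) n * r ^ n))).
    - intros n. change (Cmod (RtoC (INR (S n)) * a (S n) * z ^ n)
        <= Rabs (PS_derive (fun n => Cmod (a n)) n * r ^ n))%R.
      rewrite !Cmod_mult, Cmod_R, Cmod_pow. unfold PS_derive.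
      rewrite !Rabs_mult, (Rabs_pos_eq (Cmod _)) by apply Cmod_ge_0.
      apply Rmult_le_compat_l.
      + apply Rmult_le_pos; [apply Rabs_pos | apply Cmod_ge_0].
      + rewrite Rabs_pos_eq by (apply pow_le; lra). apply pow_incr. lra.
    - apply CV_disk_inside. rewrite CV_radius_derive, Rabs_pos_eq by lra.
      now apply (taylor_coeffs_CV_radius f). }
  destruct Hex as [l Hl]. exists l. split; [exact Hl|].
  destruct (ex_series_derive2 f a r H Hr) as [L HL].
  rewrite taylor_coeffs_iff in H.
  assert (HL0 : (0 <= L)%R).
  { apply Rle_trans with (Cmod 0); [apply Cmod_ge_0|].
    apply is_Cseries_Cmod_le with (2 := HL) (u := fun _ => RtoC 0).
    - apply is_Cseries_iff. intros e He. exists 0%nat. intros n _.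
      replace (sum_n (G := C_AbelianMonoid) (fun _ => RtoC 0) n - 0) with (RtoC 0).
      + now rewrite Cmod_0.
      + induction n as [|n IH]; [rewrite sum_O; ring|].
        rewrite sum_Sn. change (plus (G := C_AbelianMonoid)) with Cplus.
        replace (sum_n (G := C_AbelianMonoid) (fun _ => RtoC 0) n + 0 - 0)
          with (sum_n (G := C_AbelianMonoid) (fun _ => RtoC 0) n - 0) by ring. exact IH.
    - intros n. rewrite Cmod_0.
      repeat apply Rmult_le_pos; try apply pos_INR; [apply Cmod_ge_0 | apply pow_le; lra]. }
  assert (Key : forall w, (Cmod w <= r)%R ->
    (Cmod (f w - f z - l * (w - z)) <= L * (Cmod (w - z) * Cmod (w - z)))%R).
  { intros w Hw.
    assert (Hlz : is_Cseries (fun n => match n with 0%nat => RtoC 0 | S m =>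
       (w - z) * (RtoC (INR (S m)) * a (S m) * z ^ m) end) ((w - z) * l)).
    { apply is_series_decr_1. change (plus (G := C_NormedModule)) with Cplus.
      change (opp (G := C_NormedModule)) with Copp.
      replace ((w - z) * l + - 0) with ((w - z) * l) by ring.
      exact (is_series_scal_l (K := C_AbsRing) (w - z) _ _ Hl). }
    assert (Hf := is_series_minus (K := C_AbsRing) (V := C_NormedModule) _ _ _ _
      (is_series_minus (K := C_AbsRing) (V := C_NormedModule) _ _ _ _
         (H w ltac:(unfold inD; lra)) (H z Hz)) Hlz).
    (* The terms of index 0 and 1 cancel, so the series starts at index 2, where the second-order
       estimate applies. *)
    apply is_Cseries_tail in Hf; [| simpl; unfold minus, plus, opp; simpl; ring].
    apply is_Cseries_tail in Hf;
      [| simpl; unfold minus, plus, opp, scal; simpl; unfold mult; simpl; ring].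
    assert (HD : (0 <= Cmod (w - z) * Cmod (w - z))%R)
      by (apply Rmult_le_pos; apply Cmod_ge_0).
    rewrite (Cmult_comm l).
    refine (is_Cseries_Cmod_le _ _ _ _ Hf
      (is_series_scal_r (Cmod (w - z) * Cmod (w - z))%R _ _ HL) _).
    intros n.
    change (Cmod (a (S (S n)) * w ^ S (S n) + - (a (S (S n)) * z ^ S (S n))
      + - ((w - z) * (RtoC (INR (S (S n))) * a (S (S n)) * z ^ S n)))
      <= INR (S (S n)) * INR (S n) * Cmod (a (S (S n))) * r ^ n
         * (Cmod (w - z) * Cmod (w - z)))%R.
    replace (a (S (S n)) * w ^ S (S n) + - (a (S (S n)) * z ^ S (S n))
      + - ((w - z) * (RtoC (INR (S (S n))) * a (S (S n)) * z ^ S n)))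
      with (a (S (S n)) * (w ^ S (S n) - z ^ S (S n) - RtoC (INR (S (S n))) * z ^ S n * (w - z)))
      by ring.
    rewrite Cmod_mult.
    replace (INR (S (S n)) * INR (S n) * Cmod (a (S (S n))) * r ^ n * (Cmod (w - z) * Cmod (w - z)))%R
      with (Cmod (a (S (S n))) * (INR (S (S n)) * INR (S n) * r ^ n * (Cmod (w - z) * Cmod (w - z))))%R
      by ring.
    apply Rmult_le_compat_l; [apply Cmod_ge_0|].
    apply pow_second_order; lra. }
  apply cderiv_iff. intros e He.
  exists (Rmin (r - Cmod z) (e / (1 + L))). split.
  { apply Rmin_glb_lt; [lra | apply Rdiv_lt_0_compat; lra]. }
  intros w Hw.
  assert (H1 := Rlt_le_trans _ _ _ Hw (Rmin_l _ _)).
  assert (H2 := Rlt_le_trans _ _ _ Hw (Rmin_r _ _)).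
  assert (Hwr : (Cmod w <= r)%R).
  { generalize (Cmod_reverse_triangle w z). lra. }
  apply Rle_trans with (1 := Key w Hwr).
  rewrite <- Rmult_assoc. apply Rmult_le_compat_r; [apply Cmod_ge_0|].
  apply Rle_trans with (L * (e / (1 + L)))%R; [apply Rmult_le_compat_l; lra|].
  apply Rmult_le_reg_r with (1 + L)%R; [lra|].
  replace (L * (e / (1 + L)) * (1 + L))%R with (L * e)%R by (field; lra). nra.
Qed.

(** The bound includes the point 0, so for positive [n] it forces [g 0 = 0]. The sign of [M] is left
    free, whence the [Rabs M] in later estimates. *)
Definition bigO (n : nat) (g : C -> C) : Prop :=
  exists M d : R, (0 < d)%R /\ forall z, (Cmod z < d)%R -> (Cmod (g z) <= M * Cmod z ^ n)%R.

(** For |z| < 1/2 the tail is dominated by (2 |z|)^(N+1) times the tail of the absolutely convergent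
    series at 1/2. *)
Lemma taylor_remainder (f : C -> C) (a : nat -> C) (N : nat) :
  taylor_coeffs f a ->
  bigO (S N) (fun z => f z - sum_n (G := C_AbelianMonoid) (fun n => a n * z ^ n) N).
Proof.
  intros H.
  assert (Hc := taylor_coeffs_CV_radius f a (/ 2) H ltac:(lra)).
  rewrite <- (Rabs_pos_eq (/ 2)) in Hc by lra.
  apply CV_disk_inside in Hc.
  rewrite (ex_series_incr_n _ (S N)) in Hc. destruct Hc as [L HL].
  rewrite taylor_coeffs_iff in H.
  exists (2 ^ S N * L)%R, (/ 2)%R. split; [lra|]. intros z Hz.
  assert (Hz0 := Cmod_ge_0 z).
  assert (Hf : is_Cseries (fun n => a (S N + n)%nat * z ^ (S N + n))
    (f z - sum_n (G := C_AbelianMonoid) (fun n => a n * z ^ n) N)).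
  { refine (is_series_incr_n (K := C_AbsRing) (V := C_NormedModule)
      (fun n => a n * z ^ n) (S N) _ ltac:(lia) _).
    change (is_Cseries (fun n => a n * z ^ n) (f z - sum_n (G := C_AbelianMonoid) (fun n => a n * z ^ n) N
       + sum_n (G := C_AbelianMonoid) (fun n => a n * z ^ n) N)).
    match goal with |- is_series _ ?l => replace l with (f z) by ring end.
    apply H. unfold inD. lra. }
  replace (2 ^ S N * L * Cmod z ^ S N)%R with (2 ^ S N * Cmod z ^ S N * L)%R by ring.
  refine (is_Cseries_Cmod_le _ _ _ _ Hf
    (is_series_scal_l (K := R_AbsRing) (2 ^ S N * Cmod z ^ S N)%R _ _ HL) _).
  intros n. change (Cmod (a (S N + n)%nat * z ^ (S N + n)) <=
    (2 ^ S N * Cmod z ^ S N) * Rabs (Cmod (a (S N + n)%nat) * (/ 2) ^ (S N + n)))%R.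
  rewrite Cmod_mult, Cmod_pow, Rabs_pos_eq.
  2: { apply Rmult_le_pos; [apply Cmod_ge_0 | apply pow_le; lra]. }
  rewrite !pow_add.
  replace (2 ^ S N * Cmod z ^ S N * (Cmod (a (S N + n)%nat) * ((/ 2) ^ S N * (/ 2) ^ n)))%R
    with (2 ^ S N * (/ 2) ^ S N * (Cmod (a (S N + n)%nat) * (Cmod z ^ S N * (/ 2) ^ n)))%R by ring.
  rewrite <- Rpow_mult_distr, Rinv_r, pow1, Rmult_1_l by lra.
  apply Rmult_le_compat_l; [apply Cmod_ge_0|].
  apply Rmult_le_compat_l; [apply pow_le; lra|]. apply pow_incr; lra.
Qed.

(** * The complex exponential *)

Lemma Cmod_le_abs (z : C) : (Cmod z <= Rabs (Re z) + Rabs (Im z))%R.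
Proof.
  destruct z as [x y]. simpl.
  replace (x, y) with (RtoC x + Ci * RtoC y)
    by (apply injective_projections; simpl; ring).
  apply Rle_trans with (1 := Cmod_triangle _ _).
  rewrite Cmod_mult, Cmod_Ci, !Cmod_R. lra.
Qed.

Lemma im_le_Cmod (z : C) : (Rabs (Im z) <= Cmod z)%R.
Proof. apply Rle_trans with (2 := Rmax_Cmod z). apply Rmax_r. Qed.

(** The inequality 1 + x <= exp x at [a] and at [- a] gives 1 + a <= exp a <= 1/(1 - a), and 1/(1 -
    a) - 1 - a = a^2/(1 - a) <= 2 a^2. *)
Lemma exp_second_order (a : R) :
  (Rabs a <= / 2)%R -> (0 <= exp a - 1 - a <= 2 * (a * a))%R.
Proof.
  intros Ha. apply Rabs_le_between in Ha.
  assert (H1 := exp_ineq1_le a). assert (H2 := exp_ineq1_le (- a)).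
  assert (H3 : (exp a * exp (- a) = 1)%R)
    by (rewrite <- exp_plus, Rplus_opp_r; apply exp_0).
  assert (H4 : (exp a * (1 - a) <= 1)%R) by nra.
  split; [lra|]. nra.
Qed.

Lemma sin_second_order (b : R) :
  (Rabs b <= / 2)%R -> (Rabs (sin b) <= Rabs b /\ Rabs (sin b - b) <= b * b)%R.
Proof.
  assert (P : forall b, (0 <= b <= / 2)%R -> (0 <= sin b <= b /\ b - b * b <= sin b)%R).
  { clear b. intros b Hb.
    assert (Hpi := PI2_1).
    destruct (sin_bound b 0 ltac:(lra) ltac:(lra)) as [H1 _].
    unfold sin_approx, sin_term in H1. simpl in H1.
    assert (H2 : (b - b * b * b / 6 <= sin b)%R) by (eapply Rle_trans; [|exact H1]; right; field).
    assert (H3 : (sin b <= b)%R).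
    { destruct (Req_dec b 0) as [->|Hn]; [rewrite sin_0; lra|].
      apply Rlt_le, sin_lt_x. lra. }
    assert (H4 : (b * b * b <= b * b)%R) by nra. split; [split|]; nra. }
  intros Hb.
  destruct (Rle_dec 0 b) as [H0|H0].
  - rewrite (Rabs_pos_eq b) in * by lra. destruct (P b ltac:(lra)).
    rewrite Rabs_pos_eq by lra. rewrite Rabs_left1 by lra. lra.
  - rewrite (Rabs_left b) in * by lra. destruct (P (- b)%R ltac:(lra)) as [H1 H2].
    rewrite sin_neg in *. rewrite Rabs_left1 by lra. rewrite Rabs_pos_eq by lra. lra.
Qed.

Lemma cos_second_order (b : R) :
  (Rabs b <= / 2)%R -> (0 <= 1 - cos b <= b * b)%R.
Proof.
  intros Hb. replace b with (2 * (b / 2))%R at 1 2 by field. rewrite cos_2a_sin.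
  destruct (sin_second_order (b / 2)) as [H _].
  { apply Rabs_le_between in Hb. apply Rabs_le_between. lra. }
  apply Rsqr_le_abs_1 in H. unfold Rsqr in H. nra.
Qed.

Lemma cexp_plus (z w : C) : cexp (z + w) = cexp z * cexp w.
Proof.
  destruct z as [x y], w as [u v]. unfold cexp. simpl.
  rewrite exp_plus, cos_plus, sin_plus.
  apply injective_projections; simpl; ring.
Qed.

Lemma cexp_0 : cexp 0 = 1.
Proof. unfold cexp. simpl. rewrite exp_0, cos_0, sin_0. apply injective_projections; simpl; ring. Qed.

Lemma cexp_opp_r (z : C) : cexp z * cexp (- z) = 1.
Proof. rewrite <- cexp_plus, Cplus_opp_r. apply cexp_0. Qed.

Lemma cexp_neq_0 (z : C) : cexp z <> 0.
Proof.
  intros H. apply C1_nz. rewrite <- (cexp_opp_r z), H. ring.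
Qed.

Lemma Cmod_cexp (z : C) : Cmod (cexp z) = exp (Re z).
Proof.
  unfold cexp, Cmod. simpl.
  replace (exp (Re z) * cos (Im z) * (exp (Re z) * cos (Im z) * 1)
    + exp (Re z) * sin (Im z) * (exp (Re z) * sin (Im z) * 1))%R
    with (Rsqr (exp (Re z)) * (Rsqr (sin (Im z)) + Rsqr (cos (Im z))))%R by (unfold Rsqr; ring).
  rewrite sin2_cos2, Rmult_1_r. apply sqrt_Rsqr. apply Rlt_le, exp_pos.
Qed.

(** Each component is written in terms of exp a - 1 - a, 1 - cos b, sin b and sin b - b, and bounded
    by 5 |h|^2. The constant is deliberately crude: only the order 2 matters for the derivative at
    0, which the addition formula then carries to every point. *)
Lemma cexp_second_order (h : C) :
  (Cmod h <= / 2)%R -> (Cmod (cexp h - 1 - h) <= 10 * (Cmod h * Cmod h))%R.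
Proof.
  intros Hh.
  assert (Ha := re_le_Cmod h). assert (Hb := im_le_Cmod h).
  destruct h as [a b]. simpl in Ha, Hb. set (m := Cmod (a, b)) in *.
  apply Rle_trans with (1 := Cmod_le_abs _). simpl.
  assert (He := exp_second_order a ltac:(lra)).
  destruct (sin_second_order b ltac:(lra)) as [Hs1 Hs2].
  assert (Hc := cos_second_order b ltac:(lra)).
  assert (Haa : (a * a <= m * m)%R)
    by (apply Rsqr_le_abs_1; rewrite (Rabs_pos_eq m); [exact Ha | apply Cmod_ge_0]).
  assert (Hbb : (b * b <= m * m)%R)
    by (apply Rsqr_le_abs_1; rewrite (Rabs_pos_eq m); [exact Hb | apply Cmod_ge_0]).
  apply Rle_trans with (5 * (m * m) + 5 * (m * m))%R; [|lra].
  apply Rplus_le_compat.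
  - replace (exp a * cos b + - (1) + - a)%R
      with ((exp a - 1 - a) - (exp a - 1 - a) * (1 - cos b) - (1 + a) * (1 - cos b))%R by ring.
    set (E := (exp a - 1 - a)%R) in *. set (c := (1 - cos b)%R) in *.
    assert (Hc1 : (c <= 1)%R) by (assert (0 <= m)%R by apply Cmod_ge_0; nra).
    apply Rabs_le_between in Ha.
    assert (0 <= E * c <= E)%R by nra.
    assert (0 <= (1 + a) * c <= 2 * c)%R by nra.
    assert (E <= 2 * (m * m))%R by lra.
    apply Rabs_le_between. lra.
  - replace (exp a * sin b + - 0 + - b)%R
      with ((exp a - 1 - a) * sin b + a * sin b + (sin b - b))%R by ring.
    set (E := (exp a - 1 - a)%R) in *.
    apply Rle_trans with (1 := Rabs_triang _ _).
    apply Rle_trans with (Rabs (E * sin b) + Rabs (a * sin b) + b * b)%R.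
    { apply Rplus_le_compat; [apply Rabs_triang | exact Hs2]. }
    rewrite !Rabs_mult, (Rabs_pos_eq E) by lra.
    assert (Hsm : (Rabs (sin b) <= m)%R) by lra.
    assert (H1 := Rabs_pos (sin b)). assert (H2 := Rabs_pos a).
    assert (Rabs a * Rabs (sin b) <= m * m)%R by (apply Rmult_le_compat; lra).
    assert (E * Rabs (sin b) <= 2 * (m * m) * 1)%R by (apply Rmult_le_compat; lra).
    lra.
Qed.

Lemma cderiv_cexp (z : C) : cderiv cexp z (cexp z).
Proof.
  apply cderiv_iff. intros e He.
  assert (Hm := proj1 (Cmod_gt_0 _) (cexp_neq_0 z)). set (m := Cmod (cexp z)) in *.
  exists (Rmin (/ 2) (e / (10 * m))). split.
  { apply Rmin_glb_lt; [lra | apply Rdiv_lt_0_compat; lra]. }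
  intros y Hy.
  assert (H1 := Rlt_le_trans _ _ _ Hy (Rmin_l _ _)).
  assert (H2 := Rlt_le_trans _ _ _ Hy (Rmin_r _ _)).
  replace (cexp y) with (cexp z * cexp (y - z))
    by (rewrite <- cexp_plus; f_equal; ring).
  replace (cexp z * cexp (y - z) - cexp z - cexp z * (y - z))
    with (cexp z * (cexp (y - z) - 1 - (y - z))) by ring.
  rewrite Cmod_mult. fold m. assert (Hh := Cmod_ge_0 (y - z)). set (h := Cmod (y - z)) in *.
  apply Rle_trans with (m * (10 * (h * h)))%R.
  - apply Rmult_le_compat_l; [lra|]. apply cexp_second_order. unfold h in H1. lra.
  - replace (m * (10 * (h * h)))%R with (h * (10 * m) * h)%R by ring.
    apply Rmult_le_compat_r; [lra|].
    replace e with (e / (10 * m) * (10 * m))%R by (field; lra).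
    apply Rmult_le_compat_r; lra.
Qed.

Lemma taylor_coeffs_0 (f : C -> C) (a : nat -> C) : taylor_coeffs f a -> f 0 = a 0%nat.
Proof.
  intros H. destruct (taylor_remainder f a 0 H) as [M [d [Hd HM]]].
  specialize (HM 0). rewrite Cmod_0 in HM. specialize (HM Hd).
  rewrite sum_O in HM.
  assert (E : Cmod (f 0 - a 0%nat * 0 ^ 0) = 0%R).
  { apply Rle_antisym; [|apply Cmod_ge_0]. simpl in HM. simpl. lra. }
  apply Cmod_eq_0 in E. simpl in E.
  replace (f 0) with ((f 0 - a 0%nat * 1) + a 0%nat) by ring. rewrite E. ring.
Qed.

Lemma inD_0 : inD 0.
Proof. unfold inD. rewrite Cmod_0. lra. Qed.

Lemma taylor_coeffs_unique_fun (f g : C -> C) (a b : nat -> C) :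
  taylor_coeffs f a -> taylor_coeffs g b -> (forall n, a n = b n) ->
  forall z, inD z -> f z = g z.
Proof.
  intros Hf Hg E z Hz. apply is_Cseries_unique with (1 := Hf z Hz).
  apply is_series_ext with (2 := Hg z Hz). intros n. now rewrite E.
Qed.

Lemma taylor_coeffs_ext (f g : C -> C) (a : nat -> C) :
  (forall z, inD z -> f z = g z) -> taylor_coeffs f a -> taylor_coeffs g a.
Proof. intros E H z Hz. rewrite <- (E z Hz). now apply H. Qed.

(** The product of [f] and exp(-h) has derivative 0. This identifies functions known only through
    their power series: first the exponential series, later the factor E of [f1]. *)
Lemma exponential_ode_unique (f h b : C -> C) :
  (forall z, inD z -> cderiv f z (f z * b z)) ->
  (forall z, inD z -> cderiv h z (b z)) -> f 0 = cexp (h 0) ->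
  forall z, inD z -> f z = cexp (h z).
Proof.
  intros Hf Hh H0 z Hz.
  assert (E : f z * cexp (- h z) = f 0 * cexp (- h 0)).
  { apply (cderiv_zero_constant_D (fun z => f z * cexp (- h z))); [|exact Hz].
    intros w Hw.
    replace (RtoC 0) with (f w * b w * cexp (- h w) + f w * (cexp (- h w) * (- (1) * b w))) by ring.
    apply (cderiv_mult f (fun y => cexp (- h y))); [now apply Hf|].
    apply (cderiv_comp cexp (fun y => - h y) w); [apply cderiv_cexp|].
    apply (cderiv_comp Copp h w); [apply cderiv_opp_id | now apply Hh]. }
  rewrite H0, cexp_opp_r in E.
  replace (f z) with (f z * cexp (- h z) * cexp (h z)).
  - rewrite E. ring.
  - rewrite <- Cmult_assoc, (Cmult_comm (cexp (- h z))), cexp_opp_r. ring.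
Qed.

Lemma RtoC_INR_neq_0 (n : nat) : RtoC (INR (S n)) <> 0.
Proof. intros H. apply RtoC_inj in H. apply (not_0_INR (S n)); [lia | exact H]. Qed.

Definition exp_coeff (n : nat) : C := RtoC (/ INR (fact n)).

Lemma exp_coeff_S (n : nat) : RtoC (INR (S n)) * exp_coeff (S n) = exp_coeff n.
Proof.
  unfold exp_coeff. rewrite <- RtoC_mult. f_equal.
  rewrite fact_simpl, mult_INR. field.
  split; [apply INR_fact_neq_0 | apply not_0_INR; lia].
Qed.

Lemma exp_coeff_le_1 (n : nat) : (Cmod (exp_coeff n) <= 1)%R.
Proof.
  unfold exp_coeff. rewrite Cmod_R.
  assert (H : (1 <= INR (fact n))%R) by (apply (le_INR 1); apply lt_O_fact).
  rewrite Rabs_pos_eq by (apply Rlt_le, Rinv_0_lt_compat; lra).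
  rewrite <- Rinv_1. apply Rinv_le_contravar; lra.
Qed.

(** The sum of the series solves y' = y, y(0) = 1 by the recurrence of its coefficients, and
    uniqueness makes it [cexp], which is defined through real functions. *)
Lemma taylor_coeffs_cexp : taylor_coeffs cexp exp_coeff.
Proof.
  destruct (taylor_coeffs_bounded_ex exp_coeff 1 exp_coeff_le_1) as [f Hf].
  destruct (taylor_coeffs_derive f _ Hf) as [H1 H2].
  apply taylor_coeffs_ext with (2 := Hf). intros z Hz.
  apply (exponential_ode_unique f (fun z => z) (fun _ => 1)); [| |  | exact Hz].
  - intros w Hw. rewrite Cmult_1_r.
    rewrite (taylor_coeffs_unique_fun f (C_derive f) _ _ Hf H2); [now apply H1 | | exact Hw].
    intros n. now rewrite exp_coeff_S.
  - intros w _. apply cderiv_id.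
  - rewrite (taylor_coeffs_0 _ _ Hf), cexp_0. unfold exp_coeff. simpl. now rewrite Rinv_1.
Qed.

(** * Operations on Taylor coefficients, and the series of cosh *)

Lemma taylor_coeffs_plus (f g : C -> C) (a b : nat -> C) :
  taylor_coeffs f a -> taylor_coeffs g b ->
  taylor_coeffs (fun z => f z + g z) (fun n => a n + b n).
Proof.
  rewrite !taylor_coeffs_iff. intros Hf Hg z Hz.
  apply is_series_ext with (2 := is_series_plus (K := C_AbsRing) (V := C_NormedModule) _ _ _ _
    (Hf z Hz) (Hg z Hz)).
  intros n. change (plus (G := C_NormedModule)) with Cplus. as_C. ring.
Qed.

Lemma taylor_coeffs_scal (c : C) (f : C -> C) (a : nat -> C) :
  taylor_coeffs f a -> taylor_coeffs (fun z => c * f z) (fun n => c * a n).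
Proof.
  rewrite !taylor_coeffs_iff. intros Hf z Hz.
  apply is_series_ext with (2 := is_series_scal (K := C_AbsRing) (V := C_NormedModule) c _ _
    (Hf z Hz)).
  intros n. change (c * (a n * z ^ n) = c * a n * z ^ n). ring.
Qed.

Lemma taylor_coeffs_comp_opp (f : C -> C) (a : nat -> C) :
  taylor_coeffs f a -> taylor_coeffs (fun z => f (- z)) (fun n => (- (1)) ^ n * a n).
Proof.
  rewrite !taylor_coeffs_iff. intros Hf z Hz.
  apply is_series_ext with (2 := Hf (- z) ltac:(unfold inD; now rewrite Cmod_opp)).
  intros n. change (a n * (- z) ^ n = (- (1)) ^ n * a n * z ^ n).
  replace (- z) with (- (1) * z) by ring. rewrite Cpow_mult_l. ring.
Qed.

Lemma taylor_coeffs_const (c : C) :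
  taylor_coeffs (fun _ => c) (fun n => match n with 0%nat => c | S _ => 0 end).
Proof.
  apply taylor_coeffs_iff. intros z Hz. apply is_Cseries_iff. intros e He. exists 0%nat.
  intros n _.
  replace (sum_n (G := C_AbelianMonoid)
    (fun n => match n with 0%nat => c | S _ => 0 end * z ^ n) n - c) with (RtoC 0).
  - now rewrite Cmod_0.
  - induction n as [|n IH]; [rewrite sum_O; simpl; ring|].
    rewrite sum_Sn. change (plus (G := C_AbelianMonoid)) with Cplus.
    rewrite Cmult_0_l, Cplus_0_r. exact IH.
Qed.

Lemma taylor_coeffs_shift (f g : C -> C) (a : nat -> C) :
  taylor_coeffs f a -> taylor_coeffs g (fun n => a (S n)) ->
  forall z, inD z -> f z = a 0%nat + z * g z.
Proof.
  rewrite !taylor_coeffs_iff. intros Hf Hg z Hz.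
  apply is_Cseries_unique with (1 := Hf z Hz).
  apply is_series_decr_1.
  assert (H := is_series_scal (K := C_AbsRing) (V := C_NormedModule) z _ _ (Hg z Hz)).
  match goal with |- is_series _ ?l => replace l with (z * g z) end.
  - apply is_series_ext with (2 := H). intros n.
    change (z * (a (S n) * z ^ n) = a (S n) * (z * z ^ n)). ring.
  - change (z * g z = a 0%nat + z * g z + - (a 0%nat * 1)). ring.
Qed.

Lemma taylor_coeffs_unshift (g : C -> C) (a : nat -> C) :
  taylor_coeffs g a ->
  taylor_coeffs (fun z => z * g z) (fun n => match n with 0%nat => 0 | S m => a m end).
Proof.
  rewrite !taylor_coeffs_iff. intros Hg z Hz.
  apply is_series_decr_1.
  assert (H := is_series_scal (K := C_AbsRing) (V := C_NormedModule) z _ _ (Hg z Hz)).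
  match goal with |- is_series _ ?l => replace l with (z * g z) end.
  - apply is_series_ext with (2 := H). intros n.
    change (z * (a n * z ^ n) = a n * (z * z ^ n)). ring.
  - change (z * g z = z * g z + - (0 * 1)). ring.
Qed.

Definition cosh_coeff (n : nat) : C := / RtoC 2 * (exp_coeff n + (- (1)) ^ n * exp_coeff n).

Lemma taylor_coeffs_ccosh : taylor_coeffs ccosh cosh_coeff.
Proof.
  apply taylor_coeffs_ext with (f := fun z => / RtoC 2 * (cexp z + cexp (- z))).
  { intros z _. unfold ccosh, Cdiv. apply Cmult_comm. }
  apply taylor_coeffs_scal. apply taylor_coeffs_plus; [apply taylor_coeffs_cexp|].
  apply taylor_coeffs_comp_opp. apply taylor_coeffs_cexp.
Qed.

Lemma cosh_coeff_le_1 (n : nat) : (Cmod (cosh_coeff n) <= 1)%R.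
Proof.
  unfold cosh_coeff. rewrite Cmod_mult.
  rewrite <- RtoC_inv, Cmod_R, Rabs_pos_eq by lra.
  assert (H : (Cmod (exp_coeff n + (- (1)) ^ n * exp_coeff n) <= 2)%R).
  { apply Rle_trans with (1 := Cmod_triangle _ _).
    rewrite Cmod_mult, Cmod_pow, Cmod_m1, pow1. generalize (exp_coeff_le_1 n). lra. }
  lra.
Qed.

Lemma cosh_coeff_values :
  cosh_coeff 0 = 1 /\ cosh_coeff 1 = 0 /\ cosh_coeff 2 = / RtoC 2.
Proof.
  unfold cosh_coeff, exp_coeff. simpl.
  repeat split; apply injective_projections; simpl; field.
Qed.

Lemma cderiv_ccosh (z : C) : exists l, cderiv ccosh z l.
Proof.
  exists ((cexp z + cexp (- z) * (- (1))) * / RtoC 2 + (cexp z + cexp (- z)) * 0).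
  apply (cderiv_mult (fun z => cexp z + cexp (- z)) (fun _ => / RtoC 2)); [|apply cderiv_const].
  apply cderiv_plus; [apply cderiv_cexp|].
  apply (cderiv_comp cexp Copp); [apply cderiv_cexp | apply cderiv_opp_id].
Qed.

(** * Order of vanishing at 0, and Goursat's theorem *)

Lemma bigO_ext (n : nat) (f g : C -> C) : (forall z, f z = g z) -> bigO n f -> bigO n g.
Proof.
  intros E [M [d [Hd H]]]. exists M, d. split; [exact Hd|].
  intros z Hz. rewrite <- E. now apply H.
Qed.

Lemma bigO_plus (n : nat) (f g : C -> C) :
  bigO n f -> bigO n g -> bigO n (fun z => f z + g z).
Proof.
  intros [M [d [Hd H]]] [M' [d' [Hd' H']]]. exists (M + M')%R, (Rmin d d').
  split; [now apply Rmin_glb_lt|]. intros z Hz.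
  apply Rle_trans with (1 := Cmod_triangle _ _). rewrite Rmult_plus_distr_r.
  apply Rplus_le_compat.
  - apply H. apply Rlt_le_trans with (1 := Hz), Rmin_l.
  - apply H'. apply Rlt_le_trans with (1 := Hz), Rmin_r.
Qed.

Lemma bigO_mult (n m : nat) (f g : C -> C) :
  bigO n f -> bigO m g -> bigO (n + m) (fun z => f z * g z).
Proof.
  intros [M [d [Hd H]]] [M' [d' [Hd' H']]]. exists (M * M')%R, (Rmin d d').
  split; [now apply Rmin_glb_lt|]. intros z Hz.
  rewrite Cmod_mult, pow_add.
  replace (M * M' * (Cmod z ^ n * Cmod z ^ m))%R with (M * Cmod z ^ n * (M' * Cmod z ^ m))%R by ring.
  apply Rmult_le_compat; try apply Cmod_ge_0.
  - apply H. apply Rlt_le_trans with (1 := Hz), Rmin_l.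
  - apply H'. apply Rlt_le_trans with (1 := Hz), Rmin_r.
Qed.

Lemma bigO_weaken (m n : nat) (f : C -> C) : (m <= n)%nat -> bigO n f -> bigO m f.
Proof.
  intros Hmn [M [d [Hd H]]]. exists (Rabs M), (Rmin d 1). split; [apply Rmin_glb_lt; lra|].
  intros z Hz. assert (Hz0 := Cmod_ge_0 z).
  assert (H1 := Rlt_le_trans _ _ _ Hz (Rmin_l _ _)).
  assert (H2 := Rlt_le_trans _ _ _ Hz (Rmin_r _ _)).
  apply Rle_trans with (1 := H z H1).
  apply Rle_trans with (Rabs M * Cmod z ^ n)%R.
  { apply Rmult_le_compat_r; [now apply pow_le | apply Rle_abs]. }
  apply Rmult_le_compat_l; [apply Rabs_pos|].
  replace n with (m + (n - m))%nat by lia. rewrite pow_add.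
  rewrite <- Rmult_1_r. apply Rmult_le_compat_l; [now apply pow_le|].
  rewrite <- (pow1 (n - m)). apply pow_incr. lra.
Qed.

Lemma bigO_monomial (c : C) (n : nat) : bigO n (fun z => c * z ^ n).
Proof.
  exists (Cmod c), 1%R. split; [lra|]. intros z _. rewrite Cmod_mult, Cmod_pow. lra.
Qed.

Lemma bigO_const (c : C) : bigO 0 (fun _ => c).
Proof. apply bigO_ext with (2 := bigO_monomial c 0). intros z. simpl. ring. Qed.

Lemma bigO_scal (c : C) (n : nat) (f : C -> C) : bigO n f -> bigO n (fun z => c * f z).
Proof. apply (bigO_mult 0 n (fun _ => c)). apply bigO_const. Qed.

(** * Complex-valued integrals over real intervals, and integrals around rectangles *)

Notation CRInt := (RInt (V := C_R_CompleteNormedModule)).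
Notation is_CRInt := (is_RInt (V := C_R_NormedModule)).
Notation ex_CRInt := (ex_RInt (V := C_R_NormedModule)).

Lemma is_CRInt_unique (g : R -> C) (a b : R) (l : C) : is_CRInt g a b l -> CRInt g a b = l.
Proof. exact (is_RInt_unique (V := C_R_CompleteNormedModule) g a b l). Qed.

Lemma CRInt_correct (g : R -> C) (a b : R) : ex_CRInt g a b -> is_CRInt g a b (CRInt g a b).
Proof. exact (RInt_correct (V := C_R_CompleteNormedModule) g a b). Qed.

Lemma continuous_R_C (g : R -> C) (t : R) :
  (forall e : R, (0 < e)%R -> exists d : R, (0 < d)%R /\
     forall u : R, (Rabs (u - t) < d)%R -> (Cmod (g u - g t) < e)%R) ->
  continuous (U := C_R_NormedModule) g t.
Proof.
  intros H. apply (filterlim_locally_ball_norm (K := R_AbsRing) (U := C_R_NormedModule)).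
  intros e. destruct (H e (cond_pos e)) as [d [Hd Hg]].
  exists (mkposreal d Hd). intros u Hu.
  unfold ball_norm. rewrite <- Cmod_norm. exact (Hg u Hu).
Qed.

(** Every path of integration used with this lemma is affine, so a Lipschitz bound on [g] is all
    that has to be supplied. *)
Lemma continuous_comp_cderiv (f : C -> C) (g : R -> C) (t : R) (l : C) (k : R) :
  cderiv f (g t) l -> (forall u, (Cmod (g u - g t) <= k * Rabs (u - t))%R) ->
  continuous (U := C_R_NormedModule) (fun u => f (g u)) t.
Proof.
  intros Hf Hg. apply continuous_R_C. intros e He.
  destruct (cderiv_continuous _ _ _ Hf e He) as [d [Hd H]].
  exists (d / (1 + Rabs k))%R. split.
  { apply Rdiv_lt_0_compat; [exact Hd | generalize (Rabs_pos k); lra]. }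
  intros u Hu. apply H. apply Rle_lt_trans with (1 := Hg u).
  assert (Hk := Rabs_pos k). assert (Hu0 := Rabs_pos (u - t)).
  apply Rle_lt_trans with ((1 + Rabs k) * Rabs (u - t))%R.
  - apply Rmult_le_compat_r; [exact Hu0 | generalize (Rle_abs k); lra].
  - apply Rmult_lt_reg_l with (/ (1 + Rabs k))%R; [apply Rinv_0_lt_compat; lra|].
    rewrite <- Rmult_assoc, Rinv_l, Rmult_1_l by lra.
    rewrite Rmult_comm. exact Hu.
Qed.

Lemma CRInt_near_const (g : R -> C) (a b : R) (k : C) (M : R) :
  (a <= b)%R -> ex_CRInt g a b ->
  (forall s, (a <= s <= b)%R -> (Cmod (g s - k) <= M)%R) ->
  (Cmod (CRInt g a b - RtoC (b - a) * k) <= (b - a) * M)%R.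
Proof.
  intros Hab Hg H.
  assert (H1 := is_RInt_minus (V := C_R_NormedModule) _ _ _ _ _ _ (CRInt_correct _ _ _ Hg)
    (is_RInt_const (V := C_R_NormedModule) a b k)).
  apply (norm_RInt_le_const _ a b _ M Hab) in H1.
  - rewrite <- Cmod_norm in H1.
    replace (RtoC (b - a) * k) with (scal (V := C_R_NormedModule) (b - a)%R k); [exact H1|].
    destruct k as [k1 k2]. apply injective_projections; simpl; unfold scal; simpl; unfold mult; simpl; ring.
  - intros s Hs. rewrite <- Cmod_norm. exact (H s Hs).
Qed.

(** The counterclockwise integral of W(z) dz around the boundary of [a,b] x [c,d]. Opposite sides
    share one integrand, so an affine [W] gives constant integrands whose two contributions visibly
    cancel. *)
Definition rect_int (W : C -> C) (a b c d : R) : C :=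
  CRInt (fun s => W (s, c) - W (s, d)) a b + Ci * CRInt (fun t => W (b, t) - W (a, t)) c d.

Definition cderivable_rect (W : C -> C) (a b c d : R) : Prop :=
  forall s t : R, (a <= s <= b)%R -> (c <= t <= d)%R -> exists l, cderiv W (s, t) l.

Lemma cderivable_rect_sub (W : C -> C) (a b c d a' b' c' d' : R) :
  cderivable_rect W a b c d -> (a <= a')%R -> (b' <= b)%R -> (c <= c')%R -> (d' <= d)%R ->
  cderivable_rect W a' b' c' d'.
Proof. intros H Ha Hb Hc Hd s t Hs Ht. apply H; lra. Qed.

Lemma ex_CRInt_horizontal (W : C -> C) (a b c d t : R) :
  cderivable_rect W a b c d -> (a <= b)%R -> (c <= t <= d)%R -> ex_CRInt (fun s => W (s, t)) a b.
Proof.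
  intros H Hab Ht. apply (ex_RInt_continuous (V := C_R_CompleteNormedModule)).
  intros s Hs. rewrite Rmin_left, Rmax_right in Hs by lra.
  destruct (H s t Hs Ht) as [l Hl].
  apply (continuous_comp_cderiv W (fun s => (s, t)) s l 1); [exact Hl|].
  intros u. replace ((u, t) - (s, t)) with (RtoC (u - s)) by (apply injective_projections; simpl; ring).
  rewrite Cmod_R. lra.
Qed.

Lemma ex_CRInt_vertical (W : C -> C) (a b c d s : R) :
  cderivable_rect W a b c d -> (c <= d)%R -> (a <= s <= b)%R -> ex_CRInt (fun t => W (s, t)) c d.
Proof.
  intros H Hcd Hs. apply (ex_RInt_continuous (V := C_R_CompleteNormedModule)).
  intros t Ht. rewrite Rmin_left, Rmax_right in Ht by lra.
  destruct (H s t Hs Ht) as [l Hl].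
  apply (continuous_comp_cderiv W (fun t => (s, t)) t l 1); [exact Hl|].
  intros u. replace ((s, u) - (s, t)) with (Ci * RtoC (u - t)) by (apply injective_projections; simpl; ring).
  rewrite Cmod_mult, Cmod_Ci, Cmod_R. lra.
Qed.

Lemma is_CRInt_minus (f g : R -> C) (a b : R) :
  ex_CRInt f a b -> ex_CRInt g a b ->
  is_CRInt (fun s => f s - g s) a b (CRInt f a b - CRInt g a b).
Proof.
  intros Hf Hg. exact (is_RInt_minus (V := C_R_NormedModule) _ _ _ _ _ _
    (CRInt_correct _ _ _ Hf) (CRInt_correct _ _ _ Hg)).
Qed.

Lemma rect_int_sides (W : C -> C) (a b c d : R) :
  cderivable_rect W a b c d -> (a <= b)%R -> (c <= d)%R ->
  rect_int W a b c d =
    CRInt (fun s => W (s, c)) a b - CRInt (fun s => W (s, d)) a b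
    + Ci * (CRInt (fun t => W (b, t)) c d - CRInt (fun t => W (a, t)) c d).
Proof.
  intros H Hab Hcd. unfold rect_int.
  rewrite (is_CRInt_unique _ _ _ _ (is_CRInt_minus _ _ a b
    (ex_CRInt_horizontal W a b c d c H Hab ltac:(lra)) (ex_CRInt_horizontal W a b c d d H Hab ltac:(lra)))).
  rewrite (is_CRInt_unique _ _ _ _ (is_CRInt_minus _ _ c d
    (ex_CRInt_vertical W a b c d b H Hcd ltac:(lra)) (ex_CRInt_vertical W a b c d a H Hcd ltac:(lra)))).
  reflexivity.
Qed.

Lemma CRInt_Chasles (f : R -> C) (a b c : R) :
  ex_CRInt f a b -> ex_CRInt f b c -> CRInt f a c = CRInt f a b + CRInt f b c.
Proof. intros H1 H2. symmetry. exact (RInt_Chasles (V := C_R_CompleteNormedModule) f a b c H1 H2). Qed.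

Lemma rect_int_quarters (W : C -> C) (a m b c n d : R) :
  cderivable_rect W a b c d -> (a <= m <= b)%R -> (c <= n <= d)%R ->
  rect_int W a b c d =
    rect_int W a m c n + rect_int W m b c n + rect_int W a m n d + rect_int W m b n d.
Proof.
  intros H Hm Hn.
  rewrite !rect_int_sides by (lra || (apply (cderivable_rect_sub W a b c d); [exact H|lra..])).
  assert (Ex : forall t, (c <= t <= d)%R -> CRInt (fun s => W (s, t)) a b
    = CRInt (fun s => W (s, t)) a m + CRInt (fun s => W (s, t)) m b).
  { intros t Ht. apply CRInt_Chasles; apply (ex_CRInt_horizontal W _ _ c d); try lra;
      apply (cderivable_rect_sub W a b c d); lra || exact H. }
  assert (Ey : forall s, (a <= s <= b)%R -> CRInt (fun t => W (s, t)) c d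
    = CRInt (fun t => W (s, t)) c n + CRInt (fun t => W (s, t)) n d).
  { intros s Hs. apply CRInt_Chasles; apply (ex_CRInt_vertical W a b); try lra;
      apply (cderivable_rect_sub W a b c d); lra || exact H. }
  rewrite (Ex c), (Ex d), (Ey a), (Ey b) by lra. ring.
Qed.

Lemma Cmod_pair_le (x y : R) : (Cmod (x, y) <= Rabs x + Rabs y)%R.
Proof. exact (Cmod_le_abs (x, y)). Qed.

(** The affine approximation at (x, y) integrates to 0 around the rectangle. The error is at most e
    times the half-perimeter at each point, and each integrand involves two points, whence the
    factor 2. *)
Lemma rect_int_local (W : C -> C) (a b c d : R) (x y : R) (l : C) (e : R) :
  cderivable_rect W a b c d -> (a <= x <= b)%R -> (c <= y <= d)%R -> (0 <= e)%R ->
  (forall s t, (a <= s <= b)%R -> (c <= t <= d)%R ->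
    (Cmod (W (s, t) - W (x, y) - l * ((s, t) - (x, y))) <= e * Cmod ((s, t) - (x, y)))%R) ->
  (Cmod (rect_int W a b c d) <= 2 * e * ((b - a + (d - c)) * (b - a + (d - c))))%R.
Proof.
  intros H Hx Hy He HW. set (L := (b - a + (d - c))%R).
  assert (HL : forall s t, (a <= s <= b)%R -> (c <= t <= d)%R ->
    (Cmod (W (s, t) - W (x, y) - l * ((s, t) - (x, y))) <= e * L)%R).
  { intros s t Hs Ht. apply Rle_trans with (1 := HW s t Hs Ht).
    apply Rmult_le_compat_l; [exact He|].
    apply Rle_trans with (1 := Cmod_pair_le _ _). simpl. unfold L.
    apply Rplus_le_compat; apply Rabs_le_between; lra. }
  assert (H1 : (Cmod (CRInt (fun s => W (s, c) - W (s, d))%C a b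
    - RtoC (b - a) * (l * (Ci * RtoC (c - d)))) <= (b - a) * (2 * e * L))%R).
  { apply CRInt_near_const; [lra| |].
    - eexists. apply is_CRInt_minus; apply (ex_CRInt_horizontal W a b c d); lra || exact H.
    - intros s Hs.
      replace (W (s, c) - W (s, d) - l * (Ci * RtoC (c - d)))
        with ((W (s, c) - W (x, y) - l * ((s, c) - (x, y)))
              - (W (s, d) - W (x, y) - l * ((s, d) - (x, y)))).
      + apply Rle_trans with (1 := Cmod_triangle_minus _ _).
        generalize (HL s c Hs ltac:(lra)) (HL s d Hs ltac:(lra)). lra.
      + replace (Ci * RtoC (c - d)) with ((s, c) - (s, d))
          by (apply injective_projections; simpl; ring). ring. }
  assert (H2 : (Cmod (CRInt (fun t => W (b, t) - W (a, t))%C c d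
    - RtoC (d - c) * (l * RtoC (b - a))) <= (d - c) * (2 * e * L))%R).
  { apply CRInt_near_const; [lra| |].
    - eexists. apply is_CRInt_minus; apply (ex_CRInt_vertical W a b c d); lra || exact H.
    - intros t Ht.
      replace (W (b, t) - W (a, t) - l * RtoC (b - a))
        with ((W (b, t) - W (x, y) - l * ((b, t) - (x, y)))
              - (W (a, t) - W (x, y) - l * ((a, t) - (x, y)))).
      + apply Rle_trans with (1 := Cmod_triangle_minus _ _).
        generalize (HL b t ltac:(lra) Ht) (HL a t ltac:(lra) Ht). lra.
      + replace (RtoC (b - a)) with ((b, t) - (a, t))
          by (apply injective_projections; simpl; ring). ring. }
  unfold rect_int.
  set (I1 := CRInt (fun s => W (s, c) - W (s, d)) a b) in *.
  set (I2 := CRInt (fun t => W (b, t) - W (a, t)) c d) in *.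
  replace (I1 + Ci * I2) with ((I1 - RtoC (b - a) * (l * (Ci * RtoC (c - d))))
     + Ci * (I2 - RtoC (d - c) * (l * RtoC (b - a)))) by (rewrite !RtoC_minus; ring).
  apply Rle_trans with (1 := Cmod_triangle _ _). rewrite Cmod_mult, Cmod_Ci.
  replace (2 * e * (L * L))%R with ((b - a) * (2 * e * L) + (d - c) * (2 * e * L))%R
    by (unfold L; ring). lra.
Qed.

Lemma nested_intervals (a b : nat -> R) :
  (forall n, (a n <= a (S n))%R) -> (forall n, (b (S n) <= b n)%R) -> (forall n, (a n <= b n)%R) ->
  exists x, forall n, (a n <= x <= b n)%R.
Proof.
  intros Ha Hb Hab.
  assert (Ha' : forall n k, (a n <= a (n + k)%nat)%R).
  { intros n k. induction k as [|k IH]; [rewrite Nat.add_0_r; lra|].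
    rewrite Nat.add_succ_r. apply Rle_trans with (1 := IH), Ha. }
  assert (Hb' : forall n k, (b (n + k)%nat <= b n)%R).
  { intros n k. induction k as [|k IH]; [rewrite Nat.add_0_r; lra|].
    rewrite Nat.add_succ_r. apply Rle_trans with (2 := IH), Hb. }
  assert (U : forall m, is_upper_bound (fun r => exists n, r = a n) (b m)).
  { intros m r [n ->]. apply Rle_trans with (1 := Ha' n m).
    apply Rle_trans with (1 := Hab _). rewrite Nat.add_comm. apply Hb'. }
  destruct (completeness (fun r => exists n, r = a n)) as [x [Hx1 Hx2]].
  - exists (b 0%nat). apply U.
  - exists (a 0%nat), 0%nat. reflexivity.
  - exists x. intros n. split; [apply Hx1; now exists n | apply Hx2, U].
Qed.

Record rectangle := Rectangle { r_left : R; r_right : R; r_bot : R; r_top : R }.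

Definition rectangle_int (W : C -> C) (r : rectangle) : C :=
  rect_int W (r_left r) (r_right r) (r_bot r) (r_top r).

(** Selects a quarter carrying at least a fourth of the modulus of the integral. The last quarter is
    the default; it qualifies whenever the other three fail, by the triangle inequality. *)
Definition bisect (W : C -> C) (r : rectangle) : rectangle :=
  let (a, b, c, d) := r in
  let m := ((a + b) / 2)%R in
  let n := ((c + d) / 2)%R in
  let big r' := Rle_dec (Cmod (rect_int W a b c d) / 4) (Cmod (rectangle_int W r')) in
  if big (Rectangle a m c n) then Rectangle a m c n
  else if big (Rectangle m b c n) then Rectangle m b c n
  else if big (Rectangle a m n d) then Rectangle a m n d
  else Rectangle m b n d.

Lemma bisect_spec (W : C -> C) (r : rectangle) :
  cderivable_rect W (r_left r) (r_right r) (r_bot r) (r_top r) ->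
  (r_left r <= r_right r)%R -> (r_bot r <= r_top r)%R ->
  let r' := bisect W r in
  (r_left r <= r_left r')%R /\ (r_right r' <= r_right r)%R /\
  (r_right r' - r_left r' = (r_right r - r_left r) / 2)%R /\
  (r_bot r <= r_bot r')%R /\ (r_top r' <= r_top r)%R /\
  (r_top r' - r_bot r' = (r_top r - r_bot r) / 2)%R /\
  (Cmod (rectangle_int W r) / 4 <= Cmod (rectangle_int W r'))%R.
Proof.
  destruct r as [a b c d]. simpl. intros H Hab Hcd. unfold bisect.
  set (m := ((a + b) / 2)%R). set (n := ((c + d) / 2)%R).
  assert (E := rect_int_quarters W a m b c n d H ltac:(unfold m; lra) ltac:(unfold n; lra)).
  unfold rectangle_int. simpl.
  set (F := rect_int W a b c d) in *.
  set (F1 := rect_int W a m c n) in *. set (F2 := rect_int W m b c n) in *.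
  set (F3 := rect_int W a m n d) in *. set (F4 := rect_int W m b n d) in *.
  assert (D : (Cmod F / 4 <= Cmod F1 \/ Cmod F / 4 <= Cmod F2 \/
               Cmod F / 4 <= Cmod F3 \/ Cmod F / 4 <= Cmod F4)%R).
  { rewrite E. generalize (Cmod_triangle (F1 + F2 + F3) F4) (Cmod_triangle (F1 + F2) F3)
      (Cmod_triangle F1 F2). lra. }
  assert (Hm : (m - a = (b - a) / 2 /\ b - m = (b - a) / 2)%R) by (unfold m; lra).
  assert (Hn : (n - c = (d - c) / 2 /\ d - n = (d - c) / 2)%R) by (unfold n; lra).
  destruct Hm, Hn. clearbody m n. clear E.
  destruct (Rle_dec (Cmod F / 4) (Cmod F1)) as [D1|D1];
    [simpl; do 6 (split; [lra|]); exact D1|].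
  destruct (Rle_dec (Cmod F / 4) (Cmod F2)) as [D2|D2];
    [simpl; do 6 (split; [lra|]); exact D2|].
  destruct (Rle_dec (Cmod F / 4) (Cmod F3)) as [D3|D3];
    [simpl; do 6 (split; [lra|]); exact D3|].
  simpl. do 6 (split; [lra|]). fold F4.
  destruct D as [D|[D|[D|D]]]; [elim (D1 D) | elim (D2 D) | elim (D3 D) | exact D].
Qed.

(* Goursat's bisection: no continuity of the derivative is assumed. *)
Theorem rect_int_zero (W : C -> C) (a b c d : R) :
  cderivable_rect W a b c d -> (a <= b)%R -> (c <= d)%R -> rect_int W a b c d = 0.
Proof.
  intros H Hab Hcd.
  set (r := fun n => Nat.iter n (bisect W) (Rectangle a b c d)).
  assert (I : forall n,
    (a <= r_left (r n))%R /\ (r_right (r n) <= b)%R /\ (c <= r_bot (r n))%R /\ (r_top (r n) <= d)%R /\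
    (r_right (r n) - r_left (r n) = (b - a) / 2 ^ n)%R /\
    (r_top (r n) - r_bot (r n) = (d - c) / 2 ^ n)%R /\
    (Cmod (rect_int W a b c d) / 4 ^ n <= Cmod (rectangle_int W (r n)))%R).
  { induction n as [|n IH].
    - simpl. repeat split; try lra. unfold rectangle_int. simpl. lra.
    - destruct IH as [I1 [I2 [I3 [I4 [I5 [I6 I7]]]]]].
      assert (P2 : (0 < 2 ^ n)%R) by (apply pow_lt; lra).
      assert (P4 : (0 < 4 ^ n)%R) by (apply pow_lt; lra).
      assert (0 <= (b - a) / 2 ^ n)%R by (apply Rdiv_le_0_compat; lra).
      assert (0 <= (d - c) / 2 ^ n)%R by (apply Rdiv_le_0_compat; lra).
      destruct (bisect_spec W (r n)) as [J1 [J2 [J3 [J4 [J5 [J6 J7]]]]]]; try lra.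
      { apply (cderivable_rect_sub W a b c d); assumption. }
      change (r (S n)) with (bisect W (r n)).
      repeat split; try lra.
      + rewrite J3, I5. simpl. field. lra.
      + rewrite J6, I6. simpl. field. lra.
      + apply Rle_trans with (2 := J7).
        replace (Cmod (rect_int W a b c d) / 4 ^ S n)%R
          with (Cmod (rect_int W a b c d) / 4 ^ n / 4)%R by (simpl; field; lra). lra. }
  assert (Step : forall n,
    (r_left (r n) <= r_left (r (S n)))%R /\ (r_right (r (S n)) <= r_right (r n))%R /\
    (r_left (r n) <= r_right (r n))%R /\
    (r_bot (r n) <= r_bot (r (S n)))%R /\ (r_top (r (S n)) <= r_top (r n))%R /\
    (r_bot (r n) <= r_top (r n))%R).
  { intros n. destruct (I n) as [I1 [I2 [I3 [I4 [I5 [I6 _]]]]]].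
    assert (P2 : (0 < 2 ^ n)%R) by (apply pow_lt; lra).
    assert (0 <= (b - a) / 2 ^ n)%R by (apply Rdiv_le_0_compat; lra).
    assert (0 <= (d - c) / 2 ^ n)%R by (apply Rdiv_le_0_compat; lra).
    destruct (bisect_spec W (r n)) as [J1 [J2 [J3 [J4 [J5 [J6 J7]]]]]]; try lra.
    { apply (cderivable_rect_sub W a b c d); assumption. }
    change (r (S n)) with (bisect W (r n)). repeat split; lra. }
  destruct (nested_intervals (fun n => r_left (r n)) (fun n => r_right (r n))) as [x Hx];
    try (intros n; apply Step).
  destruct (nested_intervals (fun n => r_bot (r n)) (fun n => r_top (r n))) as [y Hy];
    try (intros n; apply Step).
  destruct (H x y) as [l Hl].
  { apply (Hx 0%nat). } { apply (Hy 0%nat). }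
  apply Cmod_eq_0. apply Rle_antisym; [|apply Cmod_ge_0].
  set (L := (b - a + (d - c))%R).
  assert (HL : (0 <= L)%R) by (unfold L; lra).
  apply le_epsilon. intros e He. rewrite Rplus_0_l.
  (* Chosen so that 2 e' L^2 <= e; the summand 1 covers a rectangle reduced to a point. *)
  set (e' := (e / (2 * (1 + L * L)))%R).
  assert (HLL : (0 <= L * L)%R) by (apply Rmult_le_pos; exact HL).
  assert (He' : (0 < e')%R) by (apply Rdiv_lt_0_compat; lra).
  destruct (proj1 (cderiv_iff _ _ _) Hl e' He') as [dl [Hdl HW]].
  (* With 2^N > L / dl the N-th rectangle lies in the disc of radius [dl] around (x, y), where the
     affine approximation is valid. *)
  destruct (nfloor_ex (L / dl)) as [n Hn]; [apply Rdiv_le_0_compat; lra|].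
  assert (Hn2 : (L / dl < 2 ^ S n)%R).
  { apply Rlt_trans with (1 := proj2 Hn). rewrite <- S_INR.
    clear. induction (S n) as [|k IH]; [simpl; lra|].
    rewrite S_INR. simpl. generalize (pow_R1_Rle 2 k ltac:(lra)). lra. }
  set (N := S n) in *.
  assert (P2 : (0 < 2 ^ N)%R) by (apply pow_lt; lra).
  assert (HLN : (L / 2 ^ N < dl)%R).
  { apply Rmult_lt_reg_r with (2 ^ N)%R; [exact P2|].
    replace (L / 2 ^ N * 2 ^ N)%R with (L / dl * dl)%R by (field; lra).
    rewrite (Rmult_comm dl). now apply Rmult_lt_compat_r. }
  destruct (I N) as [I1 [I2 [I3 [I4 [I5 [I6 I7]]]]]].
  assert (HrL : (r_right (r N) - r_left (r N) + (r_top (r N) - r_bot (r N)) = L / 2 ^ N)%R).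
  { rewrite I5, I6. unfold L. field. lra. }
  assert (Loc : (Cmod (rectangle_int W (r N)) <= 2 * e' * (L / 2 ^ N * (L / 2 ^ N)))%R).
  { rewrite <- HrL. unfold rectangle_int. apply (rect_int_local W _ _ _ _ x y l e').
    - apply (cderivable_rect_sub W a b c d); assumption.
    - apply (Hx N).
    - apply (Hy N).
    - lra.
    - intros s t Hs Ht. apply HW.
      apply Rle_lt_trans with (1 := Cmod_pair_le _ _). simpl.
      apply Rle_lt_trans with (2 := HLN). rewrite <- HrL.
      assert (HxN := Hx N). assert (HyN := Hy N). cbv beta in HxN, HyN.
      apply Rplus_le_compat; apply Rabs_le_between; lra. }
  assert (P4 : (4 ^ N = 2 ^ N * 2 ^ N)%R) by (rewrite <- Rpow_mult_distr; f_equal; lra).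
  (* The loss 4^(-N) from N bisections is exactly the square of the shrinking factor 2^(-N), so N
     disappears. *)
  apply Rle_trans with (2 * e' * (L * L))%R.
  - apply Rmult_le_reg_r with (/ 4 ^ N)%R; [rewrite P4; apply Rinv_0_lt_compat; nra|].
    apply Rle_trans with (1 := I7). apply Rle_trans with (1 := Loc).
    right. rewrite P4. field. lra.
  - unfold e'. apply Rmult_le_reg_r with (1 + L * L)%R; [lra|].
    replace (2 * (e / (2 * (1 + L * L))) * (L * L) * (1 + L * L))%R with (e * (L * L))%R
      by (field; lra). nra.
Qed.

(** * Circle means and the second coefficient of a Schwarz function *)

Lemma cexp_2PI (s : R) : cexp (s, (2 * PI)%R) = cexp (s, 0%R).
Proof. unfold cexp. simpl. now rewrite cos_2PI, sin_2PI, cos_0, sin_0. Qed.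

(* The integral of [g] over the circle of radius [exp s], with respect to the angle. *)
Definition circle_int (g : C -> C) (s : R) : C := CRInt (fun t => g (cexp (s, t))) 0 (2 * PI).

(** The function g(exp(s + i t)) is differentiable on [s1,s2] x [0, 2 PI] and 2 PI-periodic in t.
    The horizontal sides cancel, and the vanishing integral around the rectangle equates the two
    vertical sides. The exponential never meets 0, so [g] may be singular there. *)
Lemma circle_int_const (g : C -> C) (s1 s2 : R) :
  (forall z, inD z -> z <> 0 -> exists l, cderiv g z l) ->
  (s1 <= s2)%R -> (s2 < 0)%R ->
  circle_int g s1 = circle_int g s2.
Proof.
  intros Hg Hs Hs2. assert (Hpi := PI_RGT_0).
  set (W := fun z => g (cexp z)).
  assert (HW : cderivable_rect W s1 s2 0 (2 * PI)).
  { intros s t Hst _.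
    destruct (Hg (cexp (s, t))) as [l Hl].
    - unfold inD. rewrite Cmod_cexp. simpl. rewrite <- exp_0. apply exp_increasing. lra.
    - apply cexp_neq_0.
    - exists (l * cexp (s, t)). apply (cderiv_comp g cexp); [exact Hl | apply cderiv_cexp]. }
  assert (Z := rect_int_zero W s1 s2 0 (2 * PI) HW Hs ltac:(lra)).
  rewrite rect_int_sides in Z by (exact HW || lra).
  replace (CRInt (fun s => W (s, (2 * PI)%R)) s1 s2) with (CRInt (fun s => W (s, 0%R)) s1 s2) in Z.
  2: { apply RInt_ext. intros s _. unfold W. now rewrite cexp_2PI. }
  change (CRInt (fun t => W (s1, t)) 0 (2 * PI) = CRInt (fun t => W (s2, t)) 0 (2 * PI)).
  set (I1 := CRInt (fun t => W (s1, t)) 0 (2 * PI)) in *.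
  set (I2 := CRInt (fun t => W (s2, t)) 0 (2 * PI)) in *.
  replace I1 with (I2 + Ci * (Ci * (I2 - I1))).
  - replace (Ci * (I2 - I1)) with (RtoC 0).
    + as_C. ring.
    + rewrite <- Z. as_C. ring.
  - replace (Ci * (Ci * (I2 - I1))) with (Ci * Ci * (I2 - I1)) by ring.
    replace (Ci * Ci) with (- RtoC 1) by (apply injective_projections; simpl; ring).
    as_C. ring.
Qed.

Lemma is_CRInt_derive_line (f df : C -> C) (z v : C) (b : R) :
  (0 <= b)%R ->
  (forall t, (0 <= t <= b)%R -> cderiv f (z + RtoC t * v) (df (z + RtoC t * v))) ->
  (forall t, (0 <= t <= b)%R -> exists l, cderiv df (z + RtoC t * v) l) ->
  is_CRInt (fun t => df (z + RtoC t * v) * v) 0 b (f (z + RtoC b * v) - f z).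
Proof.
  intros Hb Hf Hdf.
  replace (f z) with (f (z + RtoC 0 * v)) by (f_equal; ring).
  apply (is_RInt_derive (V := C_R_CompleteNormedModule) (fun t => f (z + RtoC t * v))).
  - intros t Ht. rewrite Rmin_left, Rmax_right in Ht by lra.
    apply is_derive_along_line. now apply Hf.
  - intros t Ht. rewrite Rmin_left, Rmax_right in Ht by lra.
    destruct (Hdf t Ht) as [l Hl].
    apply (continuous_comp_cderiv (fun y => df y * v) (fun t => z + RtoC t * v) t
      (l * v + df (z + RtoC t * v) * 0) (Cmod v)).
    + apply cderiv_mult; [exact Hl | apply cderiv_const].
    + intros u. replace (z + RtoC u * v - (z + RtoC t * v)) with (v * RtoC (u - t))
        by (rewrite RtoC_minus; ring).
      rewrite Cmod_mult, Cmod_R. lra.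
Qed.

(** In the variable t, c exp(-s - i t) has the periodic primitive c i exp(-s - i t). This removes
    the 1/z term from the circle means. *)
Lemma is_CRInt_inv_circle (c : C) (s : R) :
  is_CRInt (fun t => c / cexp (s, t)) 0 (2 * PI) (RtoC 0).
Proof.
  assert (Hpi := PI_RGT_0).
  assert (H := is_CRInt_derive_line (fun z => c * Ci * cexp z) (fun z => c * Ci * cexp z)
    (- s, 0)%R (- Ci) (2 * PI)).
  assert (D : forall w, cderiv (fun z => c * Ci * cexp z) w (c * Ci * cexp w)).
  { intros w. replace (c * Ci * cexp w) with (0 * cexp w + c * Ci * cexp w) by ring.
    apply (cderiv_mult (fun _ => c * Ci) cexp); [apply cderiv_const | apply cderiv_cexp]. }
  specialize (H ltac:(lra) (fun t _ => D _) (fun t _ => ex_intro _ _ (D _))). cbv beta in H.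
  replace (c * Ci * cexp ((- s, 0)%R + RtoC (2 * PI) * - Ci) - c * Ci * cexp (- s, 0)%R)
    with (RtoC 0) in H.
  - apply (is_RInt_ext (V := C_R_NormedModule)) with (2 := H). intros t _.
    replace ((- s, 0)%R + RtoC t * - Ci) with (- (s, t))
      by (apply injective_projections; simpl; ring).
    replace (cexp (- (s, t))) with (/ cexp (s, t)).
    + replace (c * Ci * / cexp (s, t) * - Ci) with (- (Ci * Ci) * (c / cexp (s, t)))
        by (unfold Cdiv; ring).
      replace (Ci * Ci) with (- RtoC 1) by (apply injective_projections; simpl; ring).
      as_C. ring.
    + rewrite <- (Cmult_1_r (/ cexp (s, t))), <- (cexp_opp_r (s, t)).
      field. apply cexp_neq_0.
  - replace (cexp ((- s, 0)%R + RtoC (2 * PI) * - Ci)) with (cexp (- s, 0)%R); [ring|].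
    replace ((- s, 0)%R + RtoC (2 * PI) * - Ci) with ((- s, - (2 * PI))%R : C)
      by (apply injective_projections; simpl; ring).
    unfold cexp. simpl. now rewrite cos_neg, sin_neg, cos_2PI, sin_2PI, cos_0, sin_0, Ropp_0.
Qed.

Lemma is_RInt_weight_circle (y : C) (s : R) :
  is_RInt (fun t => Cmod (1 + y * cexp (s, t)) * Cmod (1 + y * cexp (s, t)))%R 0 (2 * PI)
    (2 * PI * (1 + Cmod y * Cmod y * (exp s * exp s)))%R.
Proof.
  set (y1 := Re y). set (y2 := Im y).
  set (K := (1 + Cmod y * Cmod y * (exp s * exp s))%R).
  (* A primitive of |1 + y z|^2 = K + 2 Re(y z) on |z| = exp s; its oscillating part takes the same
     value at 0 and 2 PI. *)
  set (F := fun t : R => (K * t + 2 * exp s * (y1 * sin t + y2 * cos t))%R).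
  set (dF := fun t : R => (K + 2 * exp s * (y1 * cos t - y2 * sin t))%R).
  assert (H : is_RInt dF 0 (2 * PI) (minus (F (2 * PI)%R) (F 0%R))).
  { apply (is_RInt_derive (V := R_CompleteNormedModule) F dF).
    - intros t _. unfold F, dF. auto_derive; [exact I | ring].
    - intros t _. apply (ex_derive_continuous (V := R_NormedModule)). unfold dF. auto_derive. exact I. }
  replace (minus (F (2 * PI)%R) (F 0%R)) with (2 * PI * K)%R in H.
  2: { unfold F, minus, plus, opp. simpl. rewrite sin_2PI, cos_2PI, sin_0, cos_0. ring. }
  apply is_RInt_ext with (2 := H). intros t _. unfold dF, K. as_R.
  assert (E : forall z : C, (Cmod z * Cmod z = Re z * Re z + Im z * Im z)%R).
  { intros z. generalize (Cmod2_alt z). simpl. lra. }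
  rewrite !E. unfold cexp, y1, y2. destruct y as [u v]. simpl.
  assert (T := sin2_cos2 t). unfold Rsqr in T.
  transitivity (1 + (u * u + v * v) * (exp s * exp s) * (sin t * sin t + cos t * cos t)
    + 2 * exp s * (u * cos t - v * sin t))%R; [rewrite T|]; ring.
Qed.

Lemma second_coeff_linear_bound (w : C -> C) (c1 c2 y : C) :
  analytic_on_D w -> (forall z, inD z -> (Cmod (w z) < 1)%R) ->
  bigO 3 (fun z => w z - (c1 * z + c2 * (z * z))) ->
  (Cmod (c2 + 2 * y * c1) <= 1 + Cmod y * Cmod y)%R.
Proof.
  intros Hw Hb HO. assert (Hpi := PI_RGT_0).
  set (A := c2 + 2 * y * c1).
  set (G := fun z => w z * ((1 + y * z) * (1 + y * z)) * (/ z * / z)).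
  set (I := circle_int G).
  assert (HG : forall z, inD z -> z <> 0 -> exists l, cderiv G z l).
  { intros z Hz Hz0. destruct (Hw z Hz) as [l Hl].
    assert (D : cderiv (fun z => 1 + y * z) z (0 + (0 * z + y * 1))).
    { apply cderiv_plus; [apply cderiv_const|].
      apply (cderiv_mult (fun _ => y) (fun z => z)); [apply cderiv_const | apply cderiv_id]. }
    eexists. unfold G.
    apply (cderiv_mult (fun z => w z * ((1 + y * z) * (1 + y * z))) (fun z => / z * / z)).
    - apply (cderiv_mult w (fun z => (1 + y * z) * (1 + y * z))); [exact Hl|].
      apply cderiv_mult; exact D.
    - apply cderiv_mult; apply (cderiv_inv z Hz0). }
  assert (HD : forall s t, (s < 0)%R -> inD (cexp (s, t))).
  { intros s t Hs. unfold inD. rewrite Cmod_cexp. simpl. rewrite <- exp_0. now apply exp_increasing. }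
  assert (Hex : forall s, (s < 0)%R -> ex_CRInt (fun t => G (cexp (s, t))) 0 (2 * PI)).
  { intros s Hs. apply (ex_CRInt_vertical (fun z => G (cexp z)) s s 0 (2 * PI) s); [|lra|lra].
    intros s' t Hs' Ht. replace s' with s by lra.
    destruct (HG (cexp (s, t)) (HD s t Hs) (cexp_neq_0 _)) as [l Hl].
    eexists. apply (cderiv_comp G cexp); [exact Hl | apply cderiv_cexp]. }
  assert (Up : forall s, (s < 0)%R ->
    (Cmod (I s) <= / (exp s * exp s) * (2 * PI * (1 + Cmod y * Cmod y * (exp s * exp s))))%R).
  { intros s Hs.
    assert (H1 := CRInt_correct _ _ _ (Hex s Hs)).
    assert (H2 := is_RInt_scal (V := R_NormedModule) _ _ _ (/ (exp s * exp s))%R _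
      (is_RInt_weight_circle y s)).
    rewrite Cmod_norm.
    refine (norm_RInt_le (V := C_R_NormedModule) _ _ 0 (2 * PI) _ _ ltac:(lra) _ H1 H2).
    intros t _. rewrite <- Cmod_norm.
    change (Cmod (G (cexp (s, t))) <= / (exp s * exp s)
      * (Cmod (1 + y * cexp (s, t)) * Cmod (1 + y * cexp (s, t))))%R.
    unfold G. rewrite !Cmod_mult, Cmod_inv, Cmod_cexp by apply cexp_neq_0. simpl Re.
    rewrite Rinv_mult. rewrite (Rmult_comm (/ _ * / _)).
    apply Rmult_le_compat_r.
    { apply Rmult_le_pos; apply Rlt_le, Rinv_0_lt_compat, exp_pos. }
    assert (Hw1 := Hb _ (HD s t Hs)).
    assert (Hk := Cmod_ge_0 (1 + y * cexp (s, t))). assert (Hw0 := Cmod_ge_0 (w (cexp (s, t)))).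
    rewrite <- (Rmult_1_l (Cmod (1 + y * cexp (s, t)) * _)) at 2.
    apply Rmult_le_compat_r; [now apply Rmult_le_pos | lra]. }
  assert (HOG : bigO 3 (fun z => w z * ((1 + y * z) * (1 + y * z)) - (c1 * z + A * (z * z)))).
  { apply bigO_ext with (fun z => (w z - (c1 * z + c2 * (z * z))) * ((1 + y * z) * (1 + y * z))
      + ((c1 * y * y + 2 * y * c2) * z ^ 3 + c2 * y * y * z ^ 4)).
    { intros z. unfold A. ring. }
    assert (B0 : bigO 0 (fun z => 1 + y * z)).
    { apply bigO_plus; [apply bigO_const|]. apply bigO_weaken with 1%nat; [lia|].
      apply bigO_ext with (2 := bigO_monomial y 1). intros z. ring. }
    apply bigO_plus.
    - apply (bigO_mult 3 0); [exact HO|]. now apply (bigO_mult 0 0).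
    - apply bigO_plus; [apply bigO_monomial|].
      apply bigO_weaken with 4%nat; [lia | apply bigO_monomial]. }
  destruct HOG as [M [d [Hd HM]]].
  assert (Low : forall s, (s < 0)%R -> (exp s < d)%R ->
    (Cmod (I s - RtoC (2 * PI) * A) <= 2 * PI * (M * exp s))%R).
  { intros s Hs Hsd.
    assert (H1 := is_CRInt_minus _ _ _ _ (Hex s Hs) (ex_intro _ _ (is_CRInt_inv_circle c1 s))).
    rewrite (is_CRInt_unique _ _ _ _ (is_CRInt_inv_circle c1 s)) in H1.
    assert (Z : forall x : C, x - 0 = x) by (intros x; ring).
    replace (CRInt (fun t => G (cexp (s, t))) 0 (2 * PI) - 0) with (I s) in H1
      by (unfold I, circle_int; symmetry; apply Z).
    assert (H2 := CRInt_near_const (fun t => G (cexp (s, t)) - c1 / cexp (s, t)) 0 (2 * PI) A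
      (M * exp s) ltac:(lra) (ex_intro _ _ H1)).
    rewrite (is_CRInt_unique _ _ _ _ H1), Rminus_0_r in H2.
    apply H2. intros t _.
    set (z := cexp (s, t)). assert (Hz : Cmod z = exp s) by (unfold z; now rewrite Cmod_cexp).
    assert (Hz0 : z <> 0) by apply cexp_neq_0.
    replace (G z - c1 / z - A)
      with ((w z * ((1 + y * z) * (1 + y * z)) - (c1 * z + A * (z * z))) * (/ z * / z))
      by (unfold G; field; exact Hz0).
    rewrite !Cmod_mult, !Cmod_inv by exact Hz0.
    assert (Hp := exp_pos s).
    apply Rmult_le_reg_r with (Cmod z * Cmod z)%R; [rewrite Hz; nra|].
    rewrite Rmult_assoc.
    replace (/ Cmod z * / Cmod z * (Cmod z * Cmod z))%R with 1%R by (field; rewrite Hz; lra).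
    rewrite Rmult_1_r. apply Rle_trans with (1 := HM z ltac:(lra)).
    rewrite Hz. right. ring. }
  (* The circle s = -1 is an arbitrary reference: its integral equals those over circles of radius
     [r] tending to 0, where the expansion of [G] identifies the limit. *)
  assert (Eq : I (-1)%R = RtoC (2 * PI) * A).
  { cut (Cmod (I (-1)%R - RtoC (2 * PI) * A) = 0%R).
    { intros H. apply Cmod_eq_0 in H.
      replace (I (-1)%R) with (I (-1)%R - RtoC (2 * PI) * A + RtoC (2 * PI) * A) by ring.
      rewrite H. ring. }
    apply Rle_antisym; [|apply Cmod_ge_0]. apply le_epsilon. intros e He. rewrite Rplus_0_l.
    set (r := Rmin (exp (-1)) (Rmin (d / 2) (e / (2 * PI * (1 + Rabs M))))).
    assert (HMp := Rabs_pos M).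
    assert (HPM : (0 < 2 * PI * (1 + Rabs M))%R) by (apply Rmult_lt_0_compat; lra).
    assert (Hr : (0 < r)%R).
    { unfold r. repeat apply Rmin_glb_lt; [apply exp_pos | lra |].
      now apply Rdiv_lt_0_compat. }
    assert (R1 : (r <= exp (-1))%R) by apply Rmin_l.
    assert (R2 : (r <= d / 2)%R) by (eapply Rle_trans; [apply Rmin_r | apply Rmin_l]).
    assert (R3 : (r <= e / (2 * PI * (1 + Rabs M)))%R) by (eapply Rle_trans; [apply Rmin_r | apply Rmin_r]).
    assert (Hln : (ln r <= -1)%R) by (rewrite <- (ln_exp (-1)); apply ln_le; assumption).
    assert (Ec : I (ln r) = I (-1)%R) by (apply circle_int_const; [exact HG | exact Hln | lra]).
    rewrite <- Ec.
    apply Rle_trans with (1 := Low (ln r) ltac:(lra) ltac:(rewrite exp_ln; lra)).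
    rewrite exp_ln by exact Hr.
    apply Rle_trans with (2 * PI * (1 + Rabs M) * r)%R.
    - replace (2 * PI * (M * r))%R with (2 * PI * M * r)%R by ring.
      apply Rmult_le_compat_r; [lra|]. apply Rmult_le_compat_l; [lra|].
      generalize (Rle_abs M). lra.
    - replace e with (2 * PI * (1 + Rabs M) * (e / (2 * PI * (1 + Rabs M))))%R by (field; lra).
      apply Rmult_le_compat_l; [lra | exact R3]. }
  apply le_epsilon. intros e He.
  assert (HA := Cmod_ge_0 A). assert (Hy := Cmod_ge_0 y).
  set (Q := (1 + Cmod y * Cmod y)%R). assert (HQ : (1 <= Q)%R) by (unfold Q; nra).
  (* the bound |A| <= exp(-2s) + |y|^2 for s < 0, at a small s *)
  set (s := (- (ln (1 + e) / 2))%R).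
  assert (Hln : (0 < ln (1 + e))%R) by (rewrite <- ln_1; apply ln_increasing; lra).
  assert (Hs : (s < 0)%R) by (unfold s; lra).
  assert (HI : I s = RtoC (2 * PI) * A).
  { rewrite <- Eq. destruct (Rle_dec s (-1)).
    - apply circle_int_const; [exact HG | assumption | lra].
    - symmetry. apply circle_int_const; [exact HG | lra | exact Hs]. }
  assert (U := Up s Hs). rewrite HI, Cmod_mult, Cmod_R, Rabs_pos_eq in U by lra.
  assert (He2 : (/ (exp s * exp s) = 1 + e)%R).
  { rewrite <- exp_plus, <- exp_Ropp. unfold s.
    replace (- (- (ln (1 + e) / 2) + - (ln (1 + e) / 2)))%R with (ln (1 + e)) by field.
    apply exp_ln. lra. }
  assert (Hp := exp_pos s).
  replace (/ (exp s * exp s) * (2 * PI * (1 + Cmod y * Cmod y * (exp s * exp s))))%R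
    with (2 * PI * (/ (exp s * exp s) + Cmod y * Cmod y))%R in U by (field; lra).
  apply Rmult_le_reg_l in U; [|lra]. rewrite He2 in U. unfold Q. lra.
Qed.

Lemma schwarz_pick_second (w : C -> C) (c1 c2 : C) :
  analytic_on_D w -> (forall z, inD z -> (Cmod (w z) < 1)%R) ->
  bigO 3 (fun z => w z - (c1 * z + c2 * (z * z))) ->
  (Cmod c2 + Cmod c1 * Cmod c1 <= 1)%R.
Proof.
  intros Hw Hb HO.
  (* The phase of [c2], taken to be 1 when [c2 = 0]. *)
  assert (K : exists u : C, Cmod u = 1%R /\ c2 = RtoC (Cmod c2) * u).
  { destruct (Ceq_dec c2 0) as [->|Hn].
    - exists 1. rewrite Cmod_1, Cmod_0. split; [reflexivity | ring].
    - assert (Hm := proj1 (Cmod_gt_0 _) Hn).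
      assert (Hm' : RtoC (Cmod c2) <> 0) by (intros H; apply RtoC_inj in H; lra).
      exists (c2 / RtoC (Cmod c2)). split; [|field; exact Hm'].
      rewrite Cmod_div by exact Hm'. rewrite Cmod_R, Rabs_pos_eq by lra. field. lra. }
  destruct K as [u [Hu1 Hu2]].
  assert (H := second_coeff_linear_bound w c1 c2 (Cconj c1 * u) Hw Hb HO).
  rewrite Cmod_mult, Cmod_conj, Hu1, Rmult_1_r in H.
  replace (c2 + 2 * (Cconj c1 * u) * c1) with (RtoC (Cmod c2 + 2 * (Cmod c1 * Cmod c1)) * u) in H.
  - rewrite Cmod_mult, Hu1, Cmod_R, Rmult_1_r in H.
    generalize (Rle_abs (Cmod c2 + 2 * (Cmod c1 * Cmod c1))). lra.
  - transitivity (RtoC (Cmod c2) * u + 2 * (c1 * Cconj c1) * u).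
    + rewrite <- Cmod2_conj, RtoC_pow, RtoC_plus, !RtoC_mult. ring.
    + rewrite <- Hu2. ring.
Qed.

(** * Expansion of the Schwarz function *)

Lemma bigO_ext_D (n : nat) (f g : C -> C) :
  (forall z, inD z -> f z = g z) -> bigO n f -> bigO n g.
Proof.
  intros E [M [d [Hd H]]]. exists M, (Rmin d 1). split; [apply Rmin_glb_lt; lra|].
  intros z Hz. rewrite <- E.
  - apply H. apply Rlt_le_trans with (1 := Hz), Rmin_l.
  - apply Rlt_le_trans with (1 := Hz), Rmin_r.
Qed.

Lemma bigO_mult_le (n m k : nat) (f g : C -> C) :
  bigO n f -> bigO m g -> (k <= n + m)%nat -> bigO k (fun z => f z * g z).
Proof. intros Hf Hg Hk. apply bigO_weaken with (n + m)%nat; [exact Hk | now apply bigO_mult]. Qed.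

Lemma bigO_id : bigO 1 (fun z => z).
Proof. apply bigO_ext with (2 := bigO_monomial 1 1). intros z. ring. Qed.

Lemma bigO_comp (n : nat) (g w : C -> C) : bigO n g -> bigO 1 w -> bigO n (fun z => g (w z)).
Proof.
  intros [M [d [Hd H]]] [K [d' [Hd' H']]].
  assert (HK := Rabs_pos K).
  exists (Rabs M * (1 + Rabs K) ^ n)%R, (Rmin d' (d / (1 + Rabs K))). split.
  { apply Rmin_glb_lt; [exact Hd' | apply Rdiv_lt_0_compat; lra]. }
  intros z Hz. assert (Hz0 := Cmod_ge_0 z).
  assert (H1 := Rlt_le_trans _ _ _ Hz (Rmin_l _ _)).
  assert (H2 := Rlt_le_trans _ _ _ Hz (Rmin_r _ _)).
  assert (Hw : (Cmod (w z) <= (1 + Rabs K) * Cmod z)%R).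
  { apply Rle_trans with (1 := H' z H1). rewrite pow_1.
    apply Rmult_le_compat_r; [exact Hz0 | generalize (Rle_abs K); lra]. }
  assert (Hwd : (Cmod (w z) < d)%R).
  { apply Rle_lt_trans with (1 := Hw). rewrite Rmult_comm.
    apply Rmult_lt_reg_r with (/ (1 + Rabs K))%R; [apply Rinv_0_lt_compat; lra|].
    rewrite Rmult_assoc, Rinv_r, Rmult_1_r by lra. exact H2. }
  apply Rle_trans with (1 := H _ Hwd).
  apply Rle_trans with (Rabs M * Cmod (w z) ^ n)%R.
  { apply Rmult_le_compat_r; [apply pow_le, Cmod_ge_0 | apply Rle_abs]. }
  rewrite Rmult_assoc, <- Rpow_mult_distr. apply Rmult_le_compat_l; [apply Rabs_pos|].
  apply pow_incr. split; [apply Cmod_ge_0 | exact Hw].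
Qed.

(** Division by z loses the value at 0, which [g 0 = 0] restores. *)
Lemma bigO_div_id (n : nat) (g : C -> C) :
  g 0 = 0 -> bigO (S (S n)) (fun z => z * g z) -> bigO (S n) g.
Proof.
  intros H0 [M [d [Hd H]]]. exists M, d. split; [exact Hd|]. intros z Hz.
  destruct (Ceq_dec z 0) as [->|Hz0].
  - rewrite H0, Cmod_0. simpl. lra.
  - apply Cmod_gt_0 in Hz0. specialize (H z Hz). rewrite Cmod_mult in H.
    apply Rmult_le_reg_l with (Cmod z); [exact Hz0|].
    apply Rle_trans with (1 := H). simpl. lra.
Qed.

Lemma bigO_cderiv (w : C -> C) (l : C) : w 0 = 0 -> cderiv w 0 l -> bigO 1 w.
Proof.
  intros H0 H. destruct (proj1 (cderiv_iff _ _ _) H 1%R Rlt_0_1) as [d [Hd Hw]].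
  exists (1 + Cmod l)%R, d. split; [exact Hd|]. intros z Hz.
  specialize (Hw z). rewrite H0 in Hw. replace (z - 0) with z in Hw by ring.
  specialize (Hw Hz).
  replace (w z) with (w z - 0 - l * z + l * z) by ring.
  apply Rle_trans with (1 := Cmod_triangle _ _). rewrite (Cmod_mult l). rewrite pow_1. lra.
Qed.

Lemma small_is_zero (c : C) (K d : R) :
  (0 < d)%R -> (forall r, (0 < r < d)%R -> (Cmod c <= K * r)%R) -> c = 0.
Proof.
  intros Hd H. apply Cmod_eq_0. apply Rle_antisym; [|apply Cmod_ge_0].
  apply le_epsilon. intros e He. rewrite Rplus_0_l.
  assert (HK := Rabs_pos K).
  assert (Hq : (0 < e / (1 + Rabs K))%R) by (apply Rdiv_lt_0_compat; lra).
  set (r := Rmin (d / 2) (e / (1 + Rabs K))).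
  assert (Hr : (0 < r)%R) by (apply Rmin_glb_lt; lra).
  assert (R1 : (r <= d / 2)%R) by apply Rmin_l.
  assert (R2 : (r <= e / (1 + Rabs K))%R) by apply Rmin_r.
  apply Rle_trans with (1 := H r ltac:(lra)).
  apply Rle_trans with ((1 + Rabs K) * (e / (1 + Rabs K)))%R.
  - apply Rle_trans with ((1 + Rabs K) * r)%R.
    + apply Rmult_le_compat_r; [lra | generalize (Rle_abs K); lra].
    + apply Rmult_le_compat_l; lra.
  - right. field. lra.
Qed.

(** Testing on small positive reals and dividing by r, then by r^2, leaves constants bounded by
    multiples of r. *)
Lemma bigO_quadratic_zero (p q : C) : bigO 3 (fun z => p * z + q * (z * z)) -> p = 0 /\ q = 0.
Proof.
  intros [M [d [Hd H]]].
  assert (P : p = 0).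
  { apply small_is_zero with (Rabs M + Cmod q)%R (Rmin d 1); [apply Rmin_glb_lt; lra|].
    intros r [Hr1 Hr2].
    assert (H1 := Rlt_le_trans _ _ _ Hr2 (Rmin_l _ _)).
    assert (H2 := Rlt_le_trans _ _ _ Hr2 (Rmin_r _ _)).
    specialize (H (RtoC r)). rewrite Cmod_R, Rabs_pos_eq in H by lra. specialize (H H1).
    apply Rmult_le_reg_r with r; [exact Hr1|].
    replace (Cmod p * r)%R with (Cmod (p * RtoC r)) by (rewrite Cmod_mult, Cmod_R, Rabs_pos_eq; lra).
    replace (p * RtoC r) with (p * RtoC r + q * (RtoC r * RtoC r) - q * (RtoC r * RtoC r)) by ring.
    apply Rle_trans with (1 := Cmod_triangle_minus _ _).
    rewrite (Cmod_mult q), Cmod_mult, Cmod_R, Rabs_pos_eq by lra.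
    assert (HM := Rle_abs M). assert (Hq := Cmod_ge_0 q).
    assert (M * r ^ 3 <= Rabs M * (r * r))%R.
    { apply Rle_trans with (Rabs M * r ^ 3)%R; [apply Rmult_le_compat_r; [apply pow_le; lra | lra]|].
      apply Rmult_le_compat_l; [apply Rabs_pos|]. simpl. nra. }
    lra. }
  split; [exact P|].
  apply small_is_zero with M d; [exact Hd|]. intros r [Hr1 Hr2].
  specialize (H (RtoC r)). rewrite Cmod_R, Rabs_pos_eq in H by lra. specialize (H Hr2).
  rewrite P in H. replace (0 * RtoC r + q * (RtoC r * RtoC r)) with (q * (RtoC r * RtoC r)) in H by ring.
  rewrite !Cmod_mult, Cmod_R, Rabs_pos_eq in H by lra.
  apply Rmult_le_reg_r with (r * r)%R; [nra|]. apply Rle_trans with (1 := H). right. ring.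
Qed.

Lemma phi_ch_expansion :
  bigO 3 (fun u => phi_ch u - (1 + u + u * u / 2)).
Proof.
  apply bigO_ext with (2 := taylor_remainder _ _ 2 taylor_coeffs_ccosh).
  intros u. rewrite !sum_Sn, sum_O.
  destruct cosh_coeff_values as [E0 [E1 E2]]. rewrite E0, E1, E2.
  change (plus (G := C_AbelianMonoid)) with Cplus. unfold phi_ch. simpl. as_C. field.
Qed.

(** Differentiability of [w] at 0 yields only w = O(z), which is bootstrapped through z f' = f
    phi(w). A first pass gives w = a2 z + O(z^2); inserted into w^2/2, it allows a second pass to
    order 3. At degree 3 the equation reads 3 a3 = a3 + a2 c1 + c2 + c1^2/2 with c1 = a2. *)
Lemma schwarz_function_expansion (f fp w : C -> C) (a : nat -> C) :
  taylor_coeffs f a -> f 0 = 0 -> cderiv f 0 1 ->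
  (forall z, inD z -> cderiv f z (fp z)) ->
  (forall z, inD z -> z <> 0 -> f z <> 0) ->
  (forall z, inD z -> zfp_over_f f fp z = phi_ch (w z)) ->
  (exists l, cderiv w 0 l) -> w 0 = 0 ->
  bigO 3 (fun z => w z -
    (a 2%nat * z + (2 * a 3%nat - 3 / 2 * (a 2%nat * a 2%nat)) * (z * z))).
Proof.
  intros Ha Hf0 Hf1 Hfp Hfn Hphi [l Hl] Hw0.
  destruct (taylor_coeffs_derive f a Ha) as [_ Hd].
  assert (A0 : a 0%nat = 0) by (rewrite <- (taylor_coeffs_0 _ _ Ha); exact Hf0).
  assert (A1 : a 1%nat = 1).
  { generalize (taylor_coeffs_0 _ _ Hd). rewrite (is_C_derive_unique f 0 1 Hf1).
    simpl. intros E. rewrite E. ring. }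
  set (a2 := a 2%nat). set (a3 := a 3%nat).
  assert (N2 : RtoC 2 <> 0) by (intros H; apply RtoC_inj in H; lra).
  assert (S1 : bigO 4 (fun z => f z - (z + a2 * z * z + a3 * z * z * z))).
  { apply bigO_ext with (2 := taylor_remainder f a 3 Ha). intros z.
    rewrite !sum_Sn, sum_O, A0, A1. change (plus (G := C_AbelianMonoid)) with Cplus.
    unfold a2, a3. simpl. as_C. ring. }
  assert (S2 : bigO 3 (fun z => fp z - (1 + 2 * a2 * z + 3 * a3 * z * z))).
  { apply bigO_ext_D with (2 := taylor_remainder _ _ 2 Hd). intros z Hz.
    rewrite (is_C_derive_unique f z (fp z) (Hfp z Hz)).
    rewrite !sum_Sn, sum_O, A1. change (plus (G := C_AbelianMonoid)) with Cplus.
    unfold a2, a3. simpl. rewrite !RtoC_plus. as_C. ring. }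
  assert (OW : bigO 1 w) by (apply bigO_cderiv with l; assumption).
  assert (S3 := bigO_comp 3 _ w phi_ch_expansion OW). cbv beta in S3.
  assert (Eq : forall z, inD z -> z * fp z = f z * phi_ch (w z)).
  { intros z Hz. rewrite <- (Hphi z Hz). unfold zfp_over_f.
    destruct (Ceq_dec z 0) as [->|Hz0].
    - rewrite Hf0. ring.
    - field. now apply Hfn. }
  set (R4 := fun z => f z - (z + a2 * z * z + a3 * z * z * z)) in *.
  set (R3 := fun z => fp z - (1 + 2 * a2 * z + 3 * a3 * z * z)) in *.
  set (rho := fun z => phi_ch (w z) - (1 + w z + w z * w z / 2)) in *.
  assert (Eq' : forall z, inD z ->
    z * (1 + 2 * a2 * z + 3 * a3 * z * z + R3 z) =
    (z + a2 * z * z + a3 * z * z * z + R4 z) * (1 + w z + w z * w z / 2 + rho z)).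
  { intros z Hz. unfold R3, R4, rho.
    replace (1 + 2 * a2 * z + 3 * a3 * z * z + (fp z - (1 + 2 * a2 * z + 3 * a3 * z * z)))
      with (fp z) by ring.
    rewrite (Eq z Hz). ring. }
  (* From here the remainders are atoms for [ring] and [field]; only their orders and the equation
     [Eq'] are kept. *)
  clearbody R3 R4 rho.
  assert (OW2 : bigO 2 (fun z => w z * w z / 2 + rho z)).
  { apply bigO_plus; [|apply bigO_weaken with 3%nat; [lia | exact S3]].
    apply (bigO_mult_le 2 0); [now apply (bigO_mult 1 1) | apply bigO_const | lia]. }
  assert (OT : bigO 1 (fun z => w z + (w z * w z / 2 + rho z))).
  { apply bigO_plus; [exact OW | apply bigO_weaken with 2%nat; [lia | exact OW2]]. }
  assert (OZ3 : bigO 3 (fun z => a3 * z * z * z + R4 z)).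
  { apply bigO_plus; [|apply bigO_weaken with 4%nat; [lia | exact S1]].
    apply bigO_ext with (2 := bigO_monomial a3 3). intros z. ring. }
  assert (OZ2 : forall c, bigO 2 (fun z => c * z * z)).
  { intros c. apply bigO_ext with (2 := bigO_monomial c 2). intros z. ring. }
  assert (V1 : bigO 2 (fun z => w z - a2 * z)).
  { apply bigO_div_id; [rewrite Hw0; ring|].
    apply bigO_ext_D with (fun z =>
      (2 * a3 * z * z) * z + z * R3 z + (- (1)) * R4 z
      + (- (1)) * ((a2 * z * z + (a3 * z * z * z + R4 z)) * (w z + (w z * w z / 2 + rho z)))
      + (- (1)) * (z * (w z * w z / 2 + rho z))).
    { intros z Hz. specialize (Eq' z Hz).
      (* The two sides differ by the difference of the two members of [Eq']; once that is added
         explicitly, the identity is polynomial. *)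
      match goal with |- ?x = ?y => replace x with
        (y + (z * (1 + 2 * a2 * z + 3 * a3 * z * z + R3 z)
          - (z + a2 * z * z + a3 * z * z * z + R4 z) * (1 + w z + w z * w z / 2 + rho z)))
        by (field; exact N2) end.
      rewrite Eq'. ring. }
    repeat apply bigO_plus; try apply bigO_scal.
    - apply (bigO_mult_le 2 1); [apply OZ2 | apply bigO_id | lia].
    - apply (bigO_mult_le 1 3); [apply bigO_id | exact S2 | lia].
    - apply bigO_weaken with 4%nat; [lia | exact S1].
    - apply (bigO_mult_le 2 1); [|exact OT | lia].
      apply bigO_plus; [apply OZ2 | apply bigO_weaken with 3%nat; [lia | exact OZ3]].
    - apply (bigO_mult_le 1 2); [apply bigO_id | exact OW2 | lia]. }
  apply bigO_div_id; [rewrite Hw0; ring|].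
  (* Second pass: w^2 - (a2 z)^2 is split as (w - a2 z)^2 + 2 a2 z (w - a2 z), so that the first
     pass makes every summand of order 4. *)
  apply bigO_ext_D with (fun z =>
    z * R3 z + (- (1)) * R4 z + (- (2)) * ((a2 * z * z) * (w z - a2 * z))
    + (- (1)) * ((a2 * z * z) * (w z * w z / 2 + rho z))
    + (- (1)) * ((a3 * z * z * z + R4 z) * (w z + (w z * w z / 2 + rho z)))
    + (- (1) / 2) * (z * ((w z - a2 * z) * (w z - a2 * z)))
    + (- (1)) * (z * rho z)).
  { intros z Hz. specialize (Eq' z Hz).
    match goal with |- ?x = ?y => replace x with
      (y + (z * (1 + 2 * a2 * z + 3 * a3 * z * z + R3 z)
        - (z + a2 * z * z + a3 * z * z * z + R4 z) * (1 + w z + w z * w z / 2 + rho z)))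
      by (field; exact N2) end.
    rewrite Eq'. ring. }
  repeat apply bigO_plus; try apply bigO_scal.
  - apply (bigO_mult_le 1 3); [apply bigO_id | exact S2 | lia].
  - exact S1.
  - apply (bigO_mult_le 2 2); [apply OZ2 | exact V1 | lia].
  - apply (bigO_mult_le 2 2); [apply OZ2 | exact OW2 | lia].
  - apply (bigO_mult_le 3 1); [exact OZ3 | exact OT | lia].
  - apply (bigO_mult_le 1 4); [apply bigO_id | now apply (bigO_mult 2 2) | lia].
  - apply (bigO_mult_le 1 3); [apply bigO_id | exact S3 | lia].
Qed.

Lemma Gamma2_schwarz (a : nat -> C) :
  Gamma2 a = - / RtoC 4 * (2 * a 3%nat - 3 / 2 * (a 2%nat * a 2%nat))
             + 3 / 8 * (a 2%nat * a 2%nat).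
Proof.
  unfold Gamma2. rewrite RtoC_div; [field | lra].
Qed.

Lemma Gamma_bounds (f : C -> C) (a : nat -> C) :
  S_ch f -> taylor_coeffs f a -> (Cmod (Gamma1 a) <= 1 / 2)%R /\ (Cmod (Gamma2 a) <= 3 / 8)%R.
Proof.
  intros [[_ [Hf0 Hf1]] [fp [Hfp [Hfn [_ [w [Hw [Hw0 [Hwb Hphi]]]]]]]]] Ha.
  assert (HO := schwarz_function_expansion f fp w a Ha Hf0 Hf1 Hfp Hfn Hphi (Hw 0 inD_0) Hw0).
  assert (H := schwarz_pick_second w _ _ Hw Hwb HO).
  rewrite Gamma2_schwarz.
  set (c2 := 2 * a 3%nat - 3 / 2 * (a 2%nat * a 2%nat)) in *.
  assert (H1 := Cmod_ge_0 (a 2%nat)). assert (H2 := Cmod_ge_0 c2).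
  assert (N : forall r : R, (r <> 0)%R -> RtoC r <> 0) by (intros r Hr E; apply Hr, RtoC_inj, E).
  split.
  - unfold Gamma1. rewrite Cmod_div by (apply N; lra). rewrite Cmod_opp, Cmod_R, Rabs_pos_eq by lra.
    assert (Cmod (a 2%nat) <= 1)%R by nra. lra.
  (* With x = |a2|^2 <= 1 and |c2| <= 1 - x, the sum is at most (1 - x)/4 + 3x/8 = 1/4 + x/8 <=
     3/8. *)
  - apply Rle_trans with (1 := Cmod_triangle _ _).
    rewrite !Cmod_mult, Cmod_opp, Cmod_inv, Cmod_div, !Cmod_R, !Rabs_pos_eq by (lra || (apply N; lra)).
    nra.
Qed.

(** * The extremal function *)

Notation Csum := (sum_n (G := C_AbelianMonoid)).

Lemma Csum_components (u : nat -> C) (n : nat) :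
  Csum u n = (sum_f_R0 (fun k => Re (u k)) n, sum_f_R0 (fun k => Im (u k)) n).
Proof.
  induction n as [|n IH].
  - rewrite sum_O. simpl. destruct (u 0%nat); reflexivity.
  - rewrite sum_Sn, IH. reflexivity.
Qed.

Lemma is_series_R_iff (u : nat -> R) (l : R) :
  is_series u l <-> forall e : R, (0 < e)%R -> exists N : nat, forall n, (N <= n)%nat ->
    (Rabs (sum_f_R0 u n - l) < e)%R.
Proof.
  split.
  - intros H e He. assert (H' : is_lim_seq (sum_n u) l) by exact H.
    apply is_lim_seq_spec in H'. destruct (H' (mkposreal e He)) as [N HN].
    exists N. intros n Hn. rewrite <- sum_n_Reals. exact (HN n Hn).
  - intros H. change (is_lim_seq (sum_n u) l). apply is_lim_seq_spec. intros e.
    destruct (H e (cond_pos e)) as [N HN]. exists N. intros n Hn.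
    rewrite sum_n_Reals. exact (HN n Hn).
Qed.

Lemma is_Cseries_components (u : nat -> C) (l : C) :
  is_Cseries u l <->
  is_series (fun n => Re (u n)) (Re l) /\ is_series (fun n => Im (u n)) (Im l).
Proof.
  rewrite is_Cseries_iff, !is_series_R_iff. split.
  - intros H. split; intros e He; destruct (H e He) as [N HN]; exists N; intros n Hn;
      apply Rle_lt_trans with (2 := HN n Hn); rewrite Csum_components.
    + exact (re_le_Cmod ((sum_f_R0 (fun k => Re (u k)) n, sum_f_R0 (fun k => Im (u k)) n) - l)).
    + exact (im_le_Cmod ((sum_f_R0 (fun k => Re (u k)) n, sum_f_R0 (fun k => Im (u k)) n) - l)).
  - intros [H1 H2] e He.
    destruct (H1 (e / 2)%R ltac:(lra)) as [N1 HN1]. destruct (H2 (e / 2)%R ltac:(lra)) as [N2 HN2].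
    exists (N1 + N2)%nat. intros n Hn. rewrite Csum_components.
    apply Rle_lt_trans with (1 := Cmod_le_abs _).
    specialize (HN1 n ltac:(lia)). specialize (HN2 n ltac:(lia)).
    unfold Re, Im, Rminus in *. simpl in *. lra.
Qed.

Lemma ex_series_Rabs_le (u : nat -> R) (v : nat -> R) :
  (forall n, (Rabs (u n) <= v n)%R) -> ex_series v -> ex_series (fun n => Rabs (u n)).
Proof.
  intros H Hv. apply (ex_series_le (V := R_CompleteNormedModule)) with (2 := Hv).
  intros n. unfold norm. simpl. unfold abs. simpl. rewrite Rabs_Rabsolu. apply H.
Qed.

(** The real and imaginary parts of the product combine four real Cauchy products, each legitimate
    by absolute convergence of the components. *)
Lemma is_Cseries_Cauchy_product (u v : nat -> C) (U V : C) :
  is_Cseries u U -> is_Cseries v V ->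
  ex_series (fun n => Cmod (u n)) -> ex_series (fun n => Cmod (v n)) ->
  is_Cseries (fun n => Csum (fun k => u k * v (n - k)%nat) n) (U * V).
Proof.
  intros Hu Hv Au Av.
  apply is_Cseries_components in Hu. apply is_Cseries_components in Hv.
  destruct Hu as [Hu1 Hu2], Hv as [Hv1 Hv2].
  assert (A1 : ex_series (fun n => Rabs (Re (u n))))
    by (apply ex_series_Rabs_le with (2 := Au); intros n; apply re_le_Cmod).
  assert (A2 : ex_series (fun n => Rabs (Im (u n))))
    by (apply ex_series_Rabs_le with (2 := Au); intros n; apply im_le_Cmod).
  assert (A3 : ex_series (fun n => Rabs (Re (v n))))
    by (apply ex_series_Rabs_le with (2 := Av); intros n; apply re_le_Cmod).
  assert (A4 : ex_series (fun n => Rabs (Im (v n))))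
    by (apply ex_series_Rabs_le with (2 := Av); intros n; apply im_le_Cmod).
  apply is_Cseries_components. split.
  - apply is_series_ext with (2 := is_series_minus _ _ _ _
      (is_series_mult _ _ _ _ Hu1 Hv1 A1 A3) (is_series_mult _ _ _ _ Hu2 Hv2 A2 A4)).
    intros n. rewrite Csum_components. symmetry. exact (minus_sum _ _ n).
  - apply is_series_ext with (2 := is_series_plus _ _ _ _
      (is_series_mult _ _ _ _ Hu1 Hv2 A1 A4) (is_series_mult _ _ _ _ Hu2 Hv1 A2 A3)).
    intros n. rewrite Csum_components. symmetry. exact (plus_sum _ _ n).
Qed.

Lemma taylor_coeffs_abs (f : C -> C) (a : nat -> C) (z : C) :
  taylor_coeffs f a -> inD z -> ex_series (fun n => Cmod (a n * z ^ n)).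
Proof.
  intros H Hz. assert (Hz0 := Cmod_ge_0 z).
  assert (Hc := taylor_coeffs_CV_radius f a (Cmod z) H (conj Hz0 Hz)).
  rewrite <- (Rabs_pos_eq (Cmod z)) in Hc by exact Hz0.
  apply CV_disk_inside in Hc. apply ex_series_ext with (2 := Hc). intros n.
  rewrite Cmod_mult, Cmod_pow. apply Rabs_pos_eq.
  apply Rmult_le_pos; [apply Cmod_ge_0 | now apply pow_le].
Qed.

Definition Cauchy_coeff (a b : nat -> C) (n : nat) : C := Csum (fun k => a k * b (n - k)%nat) n.

Lemma taylor_coeffs_mult (f g : C -> C) (a b : nat -> C) :
  taylor_coeffs f a -> taylor_coeffs g b ->
  taylor_coeffs (fun z => f z * g z) (Cauchy_coeff a b).
Proof.
  intros Hf Hg. apply taylor_coeffs_iff. intros z Hz.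
  assert (P := is_Cseries_Cauchy_product _ _ _ _
    (proj1 (taylor_coeffs_iff f a) Hf z Hz) (proj1 (taylor_coeffs_iff g b) Hg z Hz)
    (taylor_coeffs_abs f a z Hf Hz) (taylor_coeffs_abs g b z Hg Hz)).
  apply is_series_ext with (2 := P). intros n. unfold Cauchy_coeff.
  transitivity (Csum (fun k => mult (K := C_Ring) (a k * b (n - k)%nat) (z ^ n)) n).
  - apply sum_n_ext_loc. intros k Hk.
    change (a k * z ^ k * (b (n - k)%nat * z ^ (n - k)) = a k * b (n - k)%nat * z ^ n).
    replace (z ^ n) with (z ^ k * z ^ (n - k)) by (rewrite <- Cpow_add_r; f_equal; lia). ring.
  - exact (sum_n_mult_r (K := C_Ring) (z ^ n) (fun k => a k * b (n - k)%nat) n).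
Qed.

(* [ode_prefix b n] is correct at the indices up to [n] only; the diagonal is the
   coefficient sequence of the solution of [y' = b y], [y 0 = 1]. *)
Fixpoint ode_prefix (b : nat -> C) (n : nat) : nat -> C :=
  match n with
  | 0%nat => fun _ => 1
  | S m => fun k => if (k <=? m)%nat then ode_prefix b m k
                    else / RtoC (INR (S m)) * Cauchy_coeff (ode_prefix b m) b m
  end.

Definition ode_coeff (b : nat -> C) (n : nat) : C := ode_prefix b n n.

Lemma ode_prefix_diag (b : nat -> C) (n k : nat) : (k <= n)%nat -> ode_prefix b n k = ode_coeff b k.
Proof.
  induction n as [|n IH]; intros Hk.
  - replace k with 0%nat by lia. reflexivity.
  - destruct (Nat.eq_dec k (S n)) as [->|Hne]; [reflexivity|].
    simpl. destruct (Nat.leb_spec k n); [now apply IH | lia].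
Qed.

Lemma ode_coeff_S (b : nat -> C) (n : nat) :
  ode_coeff b (S n) = / RtoC (INR (S n)) * Cauchy_coeff (ode_coeff b) b n.
Proof.
  unfold ode_coeff at 1. cbn [ode_prefix].
  rewrite (proj2 (Nat.leb_gt (S n) n)) by lia. f_equal.
  apply sum_n_ext_loc. intros k Hk. now rewrite ode_prefix_diag.
Qed.

(** The convolution of index n has n + 1 terms of modulus at most 1, and the recurrence divides it
    by n + 1. Boundedness then gives convergence on the whole disc. *)
Lemma ode_coeff_le_1 (b : nat -> C) :
  (forall n, (Cmod (b n) <= 1)%R) -> forall n, (Cmod (ode_coeff b n) <= 1)%R.
Proof.
  intros Hb n. induction n as [n IH] using lt_wf_ind. destruct n as [|n].
  - unfold ode_coeff. simpl. rewrite Cmod_1. lra.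
  - rewrite ode_coeff_S, Cmod_mult, Cmod_inv, Cmod_R by apply RtoC_INR_neq_0.
    assert (Hn : (0 < INR (S n))%R) by (apply lt_0_INR; lia).
    rewrite Rabs_pos_eq by lra.
    assert (H : (Cmod (Cauchy_coeff (ode_coeff b) b n) <= INR (S n))%R).
    { unfold Cauchy_coeff. rewrite <- (Rmult_1_r (INR (S n))), <- sum_n_const.
      apply Cmod_sum_n_le. intros k Hk. rewrite Cmod_mult.
      specialize (IH k ltac:(lia)). specialize (Hb (n - k)%nat).
      generalize (Cmod_ge_0 (ode_coeff b k)) (Cmod_ge_0 (b (n - k)%nat)). nra. }
    apply Rmult_le_reg_l with (INR (S n)); [exact Hn|].
    rewrite <- Rmult_assoc, Rinv_r, Rmult_1_l, Rmult_1_r by lra. exact H.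
Qed.

(** [B] is (z + cosh z - 1)/z with its singularity at 0 removed. Its primitive [H], integrated
    termwise, satisfies E = exp(H), and H(z) is the integral in [f1]. Building [E] from coefficients
    supplies the Taylor series of [f1]. *)
Lemma f1_series : exists B E : C -> C, exists e : nat -> C,
  analytic_on_D B /\ (forall z, inD z -> z * B z = z + ccosh z - 1) /\
  taylor_coeffs E e /\ E 0 = 1 /\
  (forall z, inD z -> cderiv E z (E z * B z)) /\ (forall z, inD z -> E z <> 0) /\
  (forall z, inD z -> f1 z = z * E z).
Proof.
  destruct cosh_coeff_values as [c0 [c1 _]].
  destruct (taylor_coeffs_bounded_ex (fun n => cosh_coeff (S n)) 1) as [B0 HB0].
  { intros n. apply cosh_coeff_le_1. }
  assert (HB := taylor_coeffs_plus _ _ _ _ (taylor_coeffs_const 1) HB0). cbv beta in HB.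
  set (b := fun n => match n with 0%nat => RtoC 1 | S _ => 0 end + cosh_coeff (S n)) in HB.
  set (B := fun z => 1 + B0 z) in HB.
  assert (Hb : forall n, (Cmod (b n) <= 1)%R).
  { intros [|n]; unfold b.
    - rewrite c1, Cplus_0_r, Cmod_1. lra.
    - rewrite Cplus_0_l. apply cosh_coeff_le_1. }
  assert (HzB : forall z, inD z -> z * B z = z + ccosh z - 1).
  { intros z Hz. rewrite (taylor_coeffs_shift _ _ _ taylor_coeffs_ccosh HB0 z Hz), c0.
    unfold B. ring. }
  set (h := fun n => match n with 0%nat => RtoC 0 | S m => / RtoC (INR (S m)) * b m end).
  destruct (taylor_coeffs_bounded_ex h 1) as [H HH].
  { intros [|n]; unfold h.
    - rewrite Cmod_0. lra.
    - rewrite Cmod_mult, Cmod_inv, Cmod_R by apply RtoC_INR_neq_0.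
      assert (Hn : (1 <= INR (S n))%R) by (apply (le_INR 1); lia).
      rewrite Rabs_pos_eq by lra.
      assert (Hi : (/ INR (S n) <= 1)%R) by (rewrite <- Rinv_1; apply Rinv_le_contravar; lra).
      assert (Hi0 : (0 < / INR (S n))%R) by (apply Rinv_0_lt_compat; lra).
      specialize (Hb n). assert (Hb0 := Cmod_ge_0 (b n)). nra. }
  destruct (taylor_coeffs_derive _ _ HH) as [DH1 DH2].
  assert (DH : forall z, inD z -> cderiv H z (B z)).
  { intros z Hz. rewrite <- (taylor_coeffs_unique_fun _ _ _ _ DH2 HB); [now apply DH1 | | exact Hz].
    intros n. unfold h. field. apply RtoC_INR_neq_0. }
  destruct (taylor_coeffs_bounded_ex (ode_coeff b) 1 (ode_coeff_le_1 b Hb)) as [E HE].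
  destruct (taylor_coeffs_derive _ _ HE) as [DE1 DE2].
  assert (DE : forall z, inD z -> cderiv E z (E z * B z)).
  { intros z Hz.
    rewrite <- (taylor_coeffs_unique_fun _ _ _ _ DE2 (taylor_coeffs_mult _ _ _ _ HE HB));
      [now apply DE1 | | exact Hz].
    intros n. rewrite ode_coeff_S. field. apply RtoC_INR_neq_0. }
  assert (E0 : E 0 = 1) by exact (taylor_coeffs_0 _ _ HE).
  assert (H0 : H 0 = 0) by exact (taylor_coeffs_0 _ _ HH).
  assert (EH : forall z, inD z -> E z = cexp (H z)).
  { apply exponential_ode_unique with B; try assumption. now rewrite E0, H0, cexp_0. }
  assert (AB : analytic_on_D B).
  { intros z Hz. eexists. apply (proj1 (taylor_coeffs_derive _ _ HB) z Hz). }
  exists B, E, (ode_coeff b).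
  refine (conj AB (conj HzB (conj HE (conj E0 (conj DE (conj _ _)))))).
  - intros z Hz. rewrite (EH z Hz). apply cexp_neq_0.
  - intros z Hz. rewrite (EH z Hz). unfold f1. do 2 f_equal.
    assert (Seg : forall t, (0 <= t <= 1)%R -> inD (0 + RtoC t * z)).
    { intros t Ht. unfold inD in *. rewrite Cplus_0_l, Cmod_mult, Cmod_R, Rabs_pos_eq by lra.
      generalize (Cmod_ge_0 z). nra. }
    assert (I := is_CRInt_derive_line H B 0 z 1 ltac:(lra) (fun t Ht => DH _ (Seg t Ht))
      (fun t Ht => AB _ (Seg t Ht))).
    apply is_CRInt_unique in I. rewrite H0 in I.
    replace (H (0 + RtoC 1 * z) - 0) with (H z) in I.
    2: { replace (0 + RtoC 1 * z) with z by ring. ring. }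
    (* Integrands need to agree only on the open interval, so the division by [s = 0] in [f1] is
       never met. *)
    rewrite <- I. apply RInt_ext. intros t Ht. rewrite Rmin_left, Rmax_right in Ht by lra.
    assert (Ht0 : RtoC t <> 0) by (intros K; apply RtoC_inj in K; lra).
    specialize (HzB _ (Seg t ltac:(lra))). rewrite Cplus_0_l in *. rewrite <- HzB.
    as_C. field. exact Ht0.
Qed.

Lemma cderiv_phi_ch (z : C) : exists l, cderiv phi_ch z l.
Proof.
  destruct (cderiv_ccosh z) as [l Hl]. exists (1 + l).
  apply (cderiv_plus (fun y => y) ccosh); [apply cderiv_id | exact Hl].
Qed.

(** Applying the expansion of the Schwarz function to w z = z gives z = a2 z + c2 z^2 + O(z^3), from
    which a2 = 1 and c2 = 0 are read off for any Taylor sequence of [f1]. *)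
Lemma f1_properties :
  S_ch f1 /\ (exists a, taylor_coeffs f1 a) /\
  forall a, taylor_coeffs f1 a -> a 2%nat = 1 /\ 2 * a 3%nat - 3 / 2 * (a 2%nat * a 2%nat) = 0.
Proof.
  destruct f1_series as [B [E [e [AB [HzB [HE [E0 [DE [En F1]]]]]]]]].
  (* This is the derivative of z E: E + z E B = E (1 + z B), and 1 + z B = z + cosh z. *)
  set (fp := fun z => E z * phi_ch z).
  assert (D1 : forall z, inD z -> cderiv f1 z (fp z)).
  { intros z Hz. apply cderiv_ext_D with (fun z => z * E z); [exact Hz | |].
    - intros y Hy. now rewrite F1.
    - replace (fp z) with (1 * E z + z * (E z * B z)).
      + apply (cderiv_mult (fun z => z) E); [apply cderiv_id | now apply DE].
      + unfold fp, phi_ch. replace (z + ccosh z) with (z * B z + 1) by (rewrite (HzB z Hz); ring). ring. }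
  assert (P0 : phi_ch 0 = 1).
  { unfold phi_ch. rewrite (taylor_coeffs_0 _ _ taylor_coeffs_ccosh).
    rewrite (proj1 cosh_coeff_values). ring. }
  assert (F0 : f1 0 = 0) by (rewrite F1 by apply inD_0; ring).
  assert (D0 : cderiv f1 0 1).
  { replace (RtoC 1) with (fp 0) by (unfold fp; rewrite E0, P0; ring). apply D1, inD_0. }
  assert (Fn : forall z, inD z -> z <> 0 -> f1 z <> 0).
  { intros z Hz Hz0. rewrite F1 by exact Hz. apply Cmult_neq_0; [exact Hz0 | now apply En]. }
  assert (Q : forall z, inD z -> zfp_over_f f1 fp z = phi_ch z).
  { intros z Hz. unfold zfp_over_f. destruct (Ceq_dec z 0) as [->|Hz0]; [now rewrite P0|].
    rewrite F1 by exact Hz. unfold fp. field. split; [now apply En | exact Hz0]. }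
  split; [|split].
  - split.
    + split; [|split; assumption]. intros z Hz. exists (fp z). now apply D1.
    + exists fp. split; [exact D1|]. split; [exact Fn|]. split.
      * intros z Hz. destruct (cderiv_phi_ch z) as [l Hl]. exists l.
        apply cderiv_ext_D with phi_ch; [exact Hz | | exact Hl].
        intros y Hy. now rewrite Q.
      * exists (fun z => z). repeat split; try assumption; [|now intros].
        intros z _. exists 1. apply cderiv_id.
  - eexists. apply taylor_coeffs_ext with (2 := taylor_coeffs_unshift _ _ HE).
    intros z Hz. now rewrite F1.
  - intros a Ha.
    assert (O := schwarz_function_expansion f1 fp (fun z => z) a Ha F0 D0 D1 Fn Q
      (ex_intro _ _ (cderiv_id 0)) eq_refl).
    set (c2 := 2 * a 3%nat - 3 / 2 * (a 2%nat * a 2%nat)) in *.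
    destruct (bigO_quadratic_zero (1 - a 2%nat) (- c2)) as [Q1 Q2].
    { apply bigO_ext with (2 := O). intros z. ring. }
    split.
    + replace (a 2%nat) with (1 - (1 - a 2%nat)) by ring. rewrite Q1. ring.
    + replace c2 with (- - c2) by ring. rewrite Q2. ring.
Qed.

Theorem theorem3p1 :
  (forall (f : C -> C) (a : nat -> C),
      S_ch f -> taylor_coeffs f a ->
      (Cmod (Gamma1 a) <= 1/2)%R /\ (Cmod (Gamma2 a) <= 3/8)%R) /\
  (S_ch f1 /\ (exists a, taylor_coeffs f1 a) /\
   forall a : nat -> C, taylor_coeffs f1 a ->
     Cmod (Gamma1 a) = (1/2)%R /\ Cmod (Gamma2 a) = (3/8)%R).
Proof.
  split; [exact Gamma_bounds|].
  destruct f1_properties as [HS [Hex Hval]].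
  split; [exact HS|]. split; [exact Hex|].
  intros a Ha. destruct (Hval a Ha) as [V1 V2]. split.
  - unfold Gamma1. rewrite V1.
    replace (- RtoC 1 / RtoC 2) with (RtoC (- (1 / 2))) by (rewrite RtoC_opp, RtoC_div; [field | lra]).
    rewrite Cmod_R, Rabs_Ropp, Rabs_pos_eq; lra.
  - rewrite Gamma2_schwarz, V2, V1.
    replace (- / RtoC 4 * 0 + 3 / 8 * (1 * 1)) with (RtoC (3 / 8)) by (rewrite RtoC_div; [field | lra]).
    rewrite Cmod_R, Rabs_pos_eq; lra.
Qed.
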